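(* Let $f,h:\mathbb{R}^2\to\mathbb{H}$ have quaternion Fourier transforms $F$ and $H$ respectively. If either of the following conditions is satisfied: (1) $h\in L^1(\mathbb{R}^2,\mathbb{H})\cup L^2(\mathbb{R}^2,\mathbb{H})$, $H\in L^1(\mathbb{R}^2,\mathbb{H})$ and $f\in L^1(\mathbb{R}^2,\mathbb{H})$; (2) $h\in L^1(\mathbb{R}^2,\mathbb{H})\cup L^2(\mathbb{R}^2,\mathbb{H})$, $H\in L^1(\mathbb{R}^2,\mathbb{H})\cap L^2(\mathbb{R}^2,\mathbb{H})$ and $f\in L^2(\mathbb{R}^2,\mathbb{H})$; then $$(f\star h)(x_1,x_2)=\frac{1}{2\pi}\int_{\mathbb{R}^2}f(y_1,y_2)\,h(x_1\ominus y_1,x_2\ominus y_2)\,dy_1dy_2 .$$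
   Context: $\mathbb{H}=\{q_0+\mathbf{i}q_1+\mathbf{j}q_2+\mathbf{k}q_3: q_0,q_1,q_2,q_3\in\mathbb{R}\}$ denotes the quaternions, $\mathbf{i}^2=\mathbf{j}^2=\mathbf{k}^2=\mathbf{i}\mathbf{j}\mathbf{k}=-1$, with quaternion exponential $\mathbf{e}^{q}=\sum_{n\ge0}q^n/n!$ and norm $|q|=(q_0^2+q_1^2+q_2^2+q_3^2)^{1/2}$. $L^p(\mathbb{R}^2,\mathbb{H})$, $p=1,2$, is the space of $\mathbb{H}$-valued functions $f$ with $|f|^p$ Lebesgue integrable. Factors in products do not commute, so their order matters. The (right-sided) quaternion Fourier transform (QFT) of $f\in L^1(\mathbb{R}^2,\mathbb{H})$ is $$(\mathcal{F}f)(\omega_1,\omega_2)=\frac{1}{2\pi}\int_{\mathbb{R}^2}f(x_1,x_2)\,\mathbf{e}^{-\mathbf{i}\omega_1x_1}\mathbf{e}^{-\mathbf{j}\omega_2x_2}\,dx_1dx_2 ,$$ and the inverse QFT is $$(\mathcal{F}^{-1}G)(x_1,x_2)=\frac{1}{2\pi}\int_{\mathbb{R}^2}G(\omega_1,\omega_2)\,\mathbf{e}^{\mathbf{j}\omega_2x_2}\mathbf{e}^{\mathbf{i}\omega_1x_1}\,d\omega_1d\omega_2 \quad\text{for } G\in L^1(\mathbb{R}^2,\mathbb{H}).$$ By the Plancherel theorem the QFT extends from $L^1\cap L^2$ to a norm-preserving bijection of $L^2(\mathbb{R}^2,\mathbb{H})$; the capital letter $F$ denotes the QFT of $f\in L^1(\mathbb{R}^2,\mathbb{H})\cup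 L^2(\mathbb{R}^2,\mathbb{H})$ (in the $L^1$ or $L^2$ sense), and likewise $H$ is the QFT of $h$. Generalized translation: for $h\in L^1(\mathbb{R}^2,\mathbb{H})\cup L^2(\mathbb{R}^2,\mathbb{H})$ with $H\in L^1(\mathbb{R}^2,\mathbb{H})$, $$h(x_1\ominus y_1,x_2\ominus y_2):=\frac{1}{2\pi}\int_{\mathbb{R}^2}\mathbf{e}^{-\mathbf{i}\omega_1y_1}\mathbf{e}^{-\mathbf{j}\omega_2y_2}H(\omega_1,\omega_2)\,\mathbf{e}^{\mathbf{j}\omega_2x_2}\mathbf{e}^{\mathbf{i}\omega_1x_1}\,d\omega_1d\omega_2 .$$ Generalized convolution: for $f,h,G:=FH\in L^1(\mathbb{R}^2,\mathbb{H})\cup L^2(\mathbb{R}^2,\mathbb{H})$ (pointwise product $FH$), $$(f\star h)(x_1,x_2):=(\mathcal{F}^{-1}G)(x_1,x_2).$$ *)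

(* Defs.v *)
From HB Require Import structures.
From mathcomp Require Import all_boot all_order all_algebra.
From mathcomp Require Import all_classical all_reals all_analysis.
From mathcomp Require Import ring.

Set Implicit Arguments.
Unset Strict Implicit.
Unset Printing Implicit Defensive.

Import Order.TTheory GRing.Theory Num.Theory.
Import numFieldTopology.Exports numFieldNormedType.Exports.

Local Open Scope classical_set_scope.
Local Open Scope ring_scope.

(* Quat q0 q1 q2 q3 is q0 + i q1 + j q2 + k q3. *)
Record quat (R : Type) : Type := Quat { q0 : R; q1 : R; q2 : R; q3 : R }.

Definition quat_to_prod (R : Type) (q : quat R) : R * R * R * R :=
  (q0 q, q1 q, q2 q, q3 q).

Definition prod_to_quat (R : Type) (p : R * R * R * R) : quat R :=
  let: (a, b, c, d) := p in Quat a b c d.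

Lemma quat_to_prodK (R : Type) : cancel (@quat_to_prod R) (@prod_to_quat R).
Proof. by case. Qed.

HB.instance Definition _ (R : choiceType) :=
  Choice.copy (quat R) (can_type (@quat_to_prodK R)).

Section QuatRing.
Context (R : realType).
Implicit Types p q r : quat R.

Definition addq p q : quat R :=
  Quat (q0 p + q0 q) (q1 p + q1 q) (q2 p + q2 q) (q3 p + q3 q).

Definition oppq p : quat R := Quat (- q0 p) (- q1 p) (- q2 p) (- q3 p).

Definition mulq p q : quat R :=
  Quat (q0 p * q0 q - q1 p * q1 q - q2 p * q2 q - q3 p * q3 q)
       (q0 p * q1 q + q1 p * q0 q + q2 p * q3 q - q3 p * q2 q)
       (q0 p * q2 q - q1 p * q3 q + q2 p * q0 q + q3 p * q1 q)
       (q0 p * q3 q + q1 p * q2 q - q2 p * q1 q + q3 p * q0 q).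

Definition scaleq (a : R) p : quat R :=
  Quat (a * q0 p) (a * q1 p) (a * q2 p) (a * q3 p).

Lemma addqA : associative addq.
Proof. by move=> p q r; rewrite /addq /= !addrA. Qed.

Lemma addqC : commutative addq.
Proof. by move=> p q; congr Quat; rewrite addrC. Qed.

Lemma add0q : left_id (Quat 0 0 0 0) addq.
Proof. by case=> a b c d; rewrite /addq /= !add0r. Qed.

Lemma addNq : left_inverse (Quat 0 0 0 0) oppq addq.
Proof. by case=> a b c d; rewrite /addq /oppq /= !addNr. Qed.

HB.instance Definition _ :=
  GRing.isZmodule.Build (quat R) addqA addqC add0q addNq.

Lemma mulqA : associative mulq.
Proof. by move=> p q r; congr Quat; rewrite /=; ring. Qed.

Lemma mul1q : left_id (Quat 1 0 0 0) mulq.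
Proof. by case=> a b c d; congr Quat; rewrite /=; ring. Qed.

Lemma mulq1 : right_id (Quat 1 0 0 0) mulq.
Proof. by case=> a b c d; congr Quat; rewrite /=; ring. Qed.

Lemma mulqDl : left_distributive mulq +%R.
Proof. by move=> p q r; congr Quat; rewrite /=; ring. Qed.

Lemma mulqDr : right_distributive mulq +%R.
Proof. by move=> p q r; congr Quat; rewrite /=; ring. Qed.

Lemma oneq_neq0 : Quat 1 0 0 0 != 0 :> quat R.
Proof. by apply/eqP => -[] /eqP; rewrite oner_eq0. Qed.

HB.instance Definition _ := GRing.Zmodule_isNzRing.Build (quat R)
  mulqA mul1q mulq1 mulqDl mulqDr oneq_neq0.

Lemma scaleqA a b p : scaleq a (scaleq b p) = scaleq (a * b) p.
Proof. by rewrite /scaleq /= !mulrA. Qed.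

Lemma scale1q : left_id 1 scaleq.
Proof. by case=> a b c d; rewrite /scaleq /= !mul1r. Qed.

Lemma scaleqDr : right_distributive scaleq +%R.
Proof. by move=> a p q; congr Quat; rewrite /= mulrDr. Qed.

Lemma scaleqDl p : {morph scaleq^~ p : a b / a + b}.
Proof. by move=> a b; congr Quat; rewrite /= mulrDl. Qed.

HB.instance Definition _ := GRing.Zmodule_isLmodule.Build R (quat R)
  scaleqA scale1q scaleqDr scaleqDl.

Definition qi : quat R := Quat 0 1 0 0.
Definition qj : quat R := Quat 0 0 1 0.
Definition qk : quat R := Quat 0 0 0 1.

Lemma quat_units :
  [/\ qi ^+ 2 = -1, qj ^+ 2 = -1, qk ^+ 2 = -1 & qi * qj * qk = -1].
Proof. by split; rewrite ?expr2; congr Quat; rewrite /=; ring. Qed.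

Definition qnorm q : R :=
  Num.sqrt (q0 q ^+ 2 + q1 q ^+ 2 + q2 q ^+ 2 + q3 q ^+ 2).

Definition qlim (u : nat -> quat R) : quat R :=
  Quat (limn (fun n => q0 (u n))) (limn (fun n => q1 (u n)))
       (limn (fun n => q2 (u n))) (limn (fun n => q3 (u n))).

Definition qexp q : quat R :=
  qlim (fun n => \sum_(0 <= k < n) (k`!%:R)^-1 *: q ^+ k).

End QuatRing.

Arguments qi {R}.
Arguments qj {R}.
Arguments qk {R}.

Section QFT.
Context (R : realType).
Implicit Types f g h F G H : R * R -> quat R.

Definition lebesgue2 :
    set (measurableTypeR R * measurableTypeR R) -> \bar R :=
  (@lebesgue_measure R \x @lebesgue_measure R)%E.

HB.instance Definition _ := Measure.on lebesgue2.

(* Used only for integrable f: otherwise the components are junk values. *)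
Definition qint f : quat R :=
  Quat (\int[lebesgue2]_x q0 (f x)) (\int[lebesgue2]_x q1 (f x))
       (\int[lebesgue2]_x q2 (f x)) (\int[lebesgue2]_x q3 (f x)).

Definition borel_measurable f : Prop :=
  let mf (c : quat R -> R) := measurable_fun setT
    (fun x : measurableTypeR R * measurableTypeR R => c (f x)) in
  [/\ mf (@q0 R), mf (@q1 R), mf (@q2 R) & mf (@q3 R)].

(* lebesgue2 lives on the Borel sigma-algebra. The functions measurable for
   its completion are those that agree almost everywhere with a Borel one. *)
Definition lebesgue_measurable f : Prop :=
  exists2 g, borel_measurable g & {ae lebesgue2, forall x, f x = g x}.

Definition in_Lp (p : nat) f : Prop :=
  lebesgue_measurable f /\
  (\int[lebesgue2]_x (qnorm (f x) ^+ p)%:E < +oo)%E.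

Definition cvg_L2 (u : nat -> R * R -> quat R) f : Prop :=
  (fun n => \int[lebesgue2]_x (qnorm (u n x - f x) ^+ 2)%:E)%E
    @ \oo --> 0%E.

Definition qft_int f (w : R * R) : quat R :=
  (2 * pi)^-1 *:
  qint (fun x => f x * qexp (- (w.1 * x.1) *: qi) * qexp (- (w.2 * x.2) *: qj)).

Definition iqft_int G (x : R * R) : quat R :=
  (2 * pi)^-1 *:
  qint (fun w => G w * qexp ((w.2 * x.2) *: qj) * qexp ((w.1 * x.1) *: qi)).

Definition is_qft_L1 f F : Prop :=
  in_Lp 1 f /\ {ae lebesgue2, forall w, F w = qft_int f w}.

(* Extension by continuity of qft_int from L^1 /\ L^2 to L^2. *)
Definition is_qft_L2 f F : Prop :=
  [/\ in_Lp 2 f, in_Lp 2 F &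
      exists u : nat -> R * R -> quat R,
        [/\ forall n, in_Lp 1 (u n) /\ in_Lp 2 (u n),
            cvg_L2 u f &
            cvg_L2 (fun n => qft_int (u n)) F]].

(* A relation: in the L^2 sense, F is only determined up to a null set. *)
Definition is_qft f F : Prop := is_qft_L1 f F \/ is_qft_L2 f F.

(* For G in L^2 but not in L^1: a representative of the preimage of G under
   the bijection is_qft_L2 of L^2. *)
Definition iqft G : R * R -> quat R :=
  if `[< in_Lp 1 G >] then iqft_int G
  else xget (fun=> 0) [set g | is_qft_L2 g G].

(* h(x (-) y), where H is a transform of h. *)
Definition gtranslate H (x y : R * R) : quat R :=
  (2 * pi)^-1 *:
  qint (fun w => qexp (- (w.1 * y.1) *: qi) * qexp (- (w.2 * y.2) *: qj) * H w
                 * qexp ((w.2 * x.2) *: qj) * qexp ((w.1 * x.1) *: qi)).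

(* f * h, where F and H are transforms of f and h. *)
Definition gconv F H : R * R -> quat R := iqft (fun w => F w * H w).

End QFT.

(* Main.v *)
Require Import Defs.
From mathcomp Require Import all_boot all_order all_algebra.
From mathcomp Require Import all_classical all_reals all_analysis.
From mathcomp Require Import measurable_realfun.
From HB Require Import structures.
From mathcomp Require Import ring lra.

(** If f and H are integrable, both sides are double integrals of the integrable
function (w, y) |-> f(y) e(w, y) H(w) e'(w, x), where |e| = |e'| = 1, so Fubini
applies. If f is in L^2 and H in L^1 /\ L^2, the identity holds for a sequence
u_n in L^1 /\ L^2 with u_n -> f and QFT(u_n) -> F in L^2, and both sides pass to
the limit by Cauchy-Schwarz, provided y |-> h(x (-) y) is in L^2. Also, when f is
integrable but F is a transform in the L^2 sense, F has to be identified with the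
integral transform of f.

Both points only need the QFT to be L^2-bounded on L^1 /\ L^2, with any constant.
Writing the exponentials with sines and cosines reduces this to the real transforms
(T f)(y) = int cos(w y) f(w) dw (or with sin), iterated over the two variables.
For these, integrate (T f)^2 against the window (N^2 - y^2)_+: the result is a
quadratic form in f with kernel O(N^3 / (1 + N^2 (w -+ w')^2)), which the Schur
test bounds by O(N^2) |f|^2; since the window is at least (3/4) N^2 on
[-N/2, N/2], letting N go to infinity gives the claim. *)

Set Implicit Arguments.
Unset Strict Implicit.
Unset Printing Implicit Defensive.

Import Order.TTheory GRing.Theory Num.Theory.
Import numFieldTopology.Exports numFieldNormedType.Exports.

Local Open Scope classical_set_scope.
Local Open Scope ring_scope.

(** * Integration *)

(** The indicator of [-N, N] would be the obvious window, but its transform 2 sin(N w) / w is not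
    absolutely integrable and the Schur test yields nothing for it. The window used here vanishes at
    both ends, so its transform decays like 1 / w^2. The resulting kernel has height N^3 and width 1
    / N, hence row integrals of order N^2, the order of the window itself.

    Noncommutativity is met in two ways. In the integrable case no factor moves past another: only
    associativity (f e) (H e') = f (e (H e')) is used. In the L^2 bound, e is expanded into four
    real products of cosines and sines times the units 1, -i, -j, k. Real factors are central, so
    the kernel standing right of the function (QFT) and the kernel standing left of it (translation)
    obey the same estimate.

    In both cases F H is integrable, so its inverse transform is a genuine integral, and the formula
    holds at every point x rather than almost everywhere. *)

Section ae_invariance.
Context d (T : measurableType d) (R : realType).
Variable mu : {measure set T -> \bar R}.
Local Open Scope ereal_scope.
Import HBNNSimple.

(** The integral of a nonnegative function is a supremum over the simple functions below it. Setting
    such an [h] below [f] to zero on the null set [N] keeps its integral and puts it below [g]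
    everywhere. *)
Let le_integral_ae (f g : T -> \bar R) :
  (forall x, 0 <= f x) -> (forall x, 0 <= g x) ->
  {ae mu, forall x, f x = g x} -> \int[mu]_x f x <= \int[mu]_x g x.
Proof.
move=> f0 g0 [N [mN N0 fgN]].
rewrite ge0_integralTE// [leRHS]ge0_integralTE//.
apply: ge_ereal_sup => _ [h hf <-].
pose k := proj_nnsfun h (measurableC mN).
have -> : sintegral mu h = sintegral mu k.
  have E (p : {nnsfun T >-> R}) : sintegral mu p = \int[mu]_x (p x)%:E.
    by rewrite integral_nnsfun// patch_setT.
  rewrite !E; apply: ge0_ae_eq_integral => //.
  - exact/measurable_EFinP.
  - exact/measurable_EFinP.
  - by move=> x _; rewrite lee_fin.
  - by move=> x _; rewrite lee_fin.
  - exists N; split => // x /= /not_implyP[_ hk].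
    apply: contrapT => Nx; apply: hk.
    by rewrite mindicE mem_set// mulr1.
apply: ereal_sup_ubound; exists k => //= x.
rewrite mindicE; have [xN|xN] := boolP (x \in ~` N); last by rewrite mulr0.
rewrite mulr1; rewrite inE in xN.
by have <- : f x = g x; [apply: contrapT => fg; apply/xN/fgN|exact: hf].
Qed.

(* The functions of the theorem need not be Borel: they only agree almost everywhere
   with Borel ones. *)
Lemma ae_eq_integral_nonmeasurable (f g : T -> \bar R) :
  {ae mu, forall x, f x = g x} -> \int[mu]_x f x = \int[mu]_x g x.
Proof.
move=> fg.
have H (p q : T -> \bar R) : (forall x, 0 <= p x) -> (forall x, 0 <= q x) ->
    {ae mu, forall x, p x = q x} -> \int[mu]_x p x = \int[mu]_x q x.
  move=> p0 q0 pq; apply/eqP; rewrite eq_le !le_integral_ae//.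
  by apply: filterS pq => x ->.
rewrite integralE [RHS]integralE; congr (_ - _); apply: H => //;
  by apply: filterS fg => x fgx; rewrite ?funeposE ?funenegE fgx.
Qed.

End ae_invariance.



(** * The window and its cosine transform *)

Section one_dim.
Context (R : realType).
Notation mu := (@lebesgue_measure R).

Lemma FTC_segment (f F : R -> R) (a b : R) : a < b -> continuous f ->
  (forall x : R, is_derive x 1 F (f x)) ->
  (\int[mu]_(x in `[a, b]) (f x)%:E = (F b - F a)%:E)%E.
Proof.
move=> ab cf dF.
have cF : continuous F.
  move=> x; apply/differentiable_continuous/derivable1_diffP.
  exact: ex_derive.
rewrite (@continuous_FTC2 _ _ F)//.
- exact: continuous_subspaceT.
- split => //.
  + by apply: cvg_at_right_filter; exact: cF.
  + by apply: cvg_at_left_filter; exact: cF.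
- by move=> x _; rewrite derive1E derive_val.
Qed.

(** Monotone convergence. The degenerate segment [n = 0] is left out because [FTC_segment] asks for
    [a < b]. *)
Lemma ge0_integral_le_segments (f : R -> R) (M : \bar R) :
  measurable_fun setT f -> (forall x, 0 <= f x) ->
  (forall n : nat, (0 < n)%N ->
    \int[mu]_(x in `[(- n%:R)%R, n%:R%R]) (f x)%:E <= M)%E ->
  (\int[mu]_x (f x)%:E <= M)%E.
Proof.
move=> mf f0 fM.
pose F (n : nat) : set R := `[- n.+1%:R, n.+1%:R]%classic.
have FT : \bigcup_n F n = setT.
  apply/seteqP; split => // x _; exists (Num.truncn `|x|) => //.
  rewrite /F /= in_itv /= -ler_norml.
  exact/ltW/Num.Theory.truncnS_gt.
rewrite -FT; apply: (@cvge_le _ \oo _ _ (fun n => \int[mu]_(x in F n) (f x)%:E)%E).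
  by apply: nearW => n; exact: fM.
apply: ge0_nondecreasing_set_cvg_integral => //.
- apply/nondecreasing_seqP => n; apply/subsetPset => x.
  rewrite /F /= !in_itv /= -!ler_norml => /le_trans; apply.
  by rewrite ler_nat.
- by move=> n; exact: measurable_itv.
- move=> n; apply/measurable_EFinP; exact: measurable_funS mf.
- by move=> n x _; rewrite lee_fin.
Qed.

(** Increments of [atan] are at most [pi]. The gain 1 / N turns the height N^3 of the kernel into
    the N^2 of the Schur bound. *)
Lemma integral_cauchy_kernel (N c : R) : 0 < N ->
  (\int[mu]_x ((1 + N ^+ 2 * (x - c) ^+ 2)^-1)%:E <= (pi / N)%:E)%E.
Proof.
move=> N0.
pose f (x : R) := (1 + N ^+ 2 * (x - c) ^+ 2)^-1.
have pos x : 0 < 1 + N ^+ 2 * (x - c) ^+ 2.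
  by rewrite ltr_pwDl// mulr_ge0// sqr_ge0.
have cf : continuous f.
  move=> x; apply: cvgV; first by rewrite gt_eqF.
  apply: cvgD; first exact: cvg_cst.
  apply: cvgM; first exact: cvg_cst.
  by apply: cvgM; apply: cvgB => //; exact: cvg_cst.
apply: ge0_integral_le_segments.
- exact: continuous_measurable_fun.
- by move=> x; rewrite invr_ge0 ltW.
move=> n n0.
pose F x := N^-1 * atan (N * (x - c)).
have dF (x : R) : is_derive x 1 F (f x).
  rewrite /F; apply: is_derive_eq.
  rewrite /f /GRing.scale /= subr0 mulr1 [X in N^-1 * X]mulrC.
  by rewrite mulKf ?gt_eqF// exprMn.
have nn : - n%:R < n%:R :> R by rewrite gtrN// ltr0n.
rewrite (FTC_segment nn cf dF).
rewrite lee_fin /F -mulrBr [leRHS]mulrC ler_pM2l ?invr_gt0//.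
have := atan_ltpi2 (N * (n%:R - c)); have := atan_gtNpi2 (N * (- n%:R - c)).
lra.
Qed.

(** Two estimates of the integral [I] are added: |I| <= 2 N^3 from the size of the window, and w^2
    |I| <= 8 N from integration by parts. Together, (1 + N^2 w^2) |I| <= 10 N^3. *)
Lemma window_cos (N w : R) : 0 < N ->
  `|\int[mu]_(y in `[- N, N]) ((N ^+ 2 - y ^+ 2) * cos (w * y))| <=
  10 * N ^+ 3 / (1 + N ^+ 2 * w ^+ 2).
Proof.
move=> N0; set I := \int[mu]_(y in _) _.
have NN : - N < N by rewrite gtrN.
have ccos : continuous (fun y => cos (w * y)).
  move=> y; apply: (@continuous_comp _ _ _ (fun y => w * y) (@cos R)).
    by apply: cvgM; [exact: cvg_cst|].
  exact: continuous_cos.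
pose g y := (N ^+ 2 - y ^+ 2) * cos (w * y).
have cg : continuous g.
  move=> y; apply: cvgM; last exact: ccos.
  by apply: cvgB; [exact: cvg_cst|exact: exprn_continuous].
have int_c (h : R -> R) : continuous h ->
    mu.-integrable `[- N, N] (EFin \o h).
  move=> ch; apply: continuous_compact_integrable.
    exact: segment_compact.
  exact: continuous_subspaceT.
have bnd (h : R -> R) (M : R) : continuous h ->
    (forall y, y \in `[- N, N] -> `|h y| <= M) ->
    `|\int[mu]_(y in `[- N, N]) h y| <= M * (2 * N).
  move=> ch hM.
  apply: (le_trans (le_normr_Rintegral _ (int_c _ ch))) => //.
  have -> : M * (2 * N) = \int[mu]_(y in `[- N, N]) (cst M y).
    rewrite Rintegral_cst//= lebesgue_measure_itv /= lte_fin NN /=.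
    by rewrite opprK mulr2n mulrDl mul1r.
  apply: le_Rintegral => //.
  - exact/integrable_norm/int_c.
  - by apply: int_c => x; exact: cvg_cst.
have I1 : `|I| <= N ^+ 2 * (2 * N).
  apply: bnd => // y; rewrite in_itv /= => /andP[y1 y2].
  rewrite normrM -[leRHS]mulr1 ler_pM//; last exact: cos_max.
  have : y ^+ 2 <= N ^+ 2.
    by rewrite -ler_sqrt ?sqr_ge0// !sqrtr_sqr (gtr0_norm N0) ler_norml y1.
  have := sqr_ge0 y.
  rewrite ler_norml; lra.
(* Two integrations by parts, multiplied by w^2 so that w = 0 needs no case. *)
have I2 : w ^+ 2 * I - 2 * \int[mu]_(y in `[- N, N]) cos (w * y) =
    - 4 * N * cos (w * N).
  pose G y := w * (N ^+ 2 - y ^+ 2) * sin (w * y) - 2 * y * cos (w * y).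
  pose h y := w ^+ 2 * g y - 2 * cos (w * y).
  have ch : continuous h.
    move=> y; apply: cvgB; apply: cvgM; try exact: cvg_cst.
      exact: cg.
    exact: ccos.
  have dG (y : R) : is_derive y 1 G (h y).
    rewrite /G; apply: is_derive_eq.
    rewrite /h /g /GRing.scale /=. ring.
  have := FTC_segment NN ch dG.
  rewrite /h => /(congr1 fine).
  rewrite -[LHS]/(\int[mu]_(y in `[- N, N]) (w ^+ 2 * g y - 2 * cos (w * y))).
  rewrite RintegralB//; last 2 first.
    + by rewrite /g; apply: int_c => y; apply: cvgM; [exact: cvg_cst|exact: cg].
    + by apply: int_c => y; apply: cvgM; [exact: cvg_cst|exact: ccos].
  rewrite RintegralZl// ?RintegralZl//; [|exact: int_c|exact: int_c].
  move=> -> /=.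
  rewrite /G mulrN cosN; ring.
have I3 : `|\int[mu]_(y in `[- N, N]) cos (w * y)| <= 1 * (2 * N).
  by apply: bnd => // y _; exact: cos_max.
(* Twice the trivial bound 2 N of the cosine integral, plus the boundary term 4 N. *)
have I4 : w ^+ 2 * `|I| <= 8 * N.
  rewrite -{1}(ger0_norm (sqr_ge0 w)) -normrM.
  have -> : w ^+ 2 * I = 2 * \int[mu]_(y in `[- N, N]) cos (w * y)
    - 4 * N * cos (w * N).
    by move: I2; lra.
  apply: (le_trans (ler_normB _ _)).
  rewrite normrM normr_nat.
  have : `|4 * N * cos (w * N)| <= 4 * N.
    have N4 : 0 <= 4 * N by rewrite mulr_ge0// ltW.
    by rewrite normrM (ger0_norm N4) -[leRHS]mulr1 ler_wpM2l// cos_max.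
  lra.
rewrite ler_pdivlMr; last by rewrite ltr_pwDl// mulr_ge0// sqr_ge0.
have : N ^+ 2 * (w ^+ 2 * `|I|) <= N ^+ 2 * (8 * N).
  by rewrite ler_pM2l// exprn_gt0.
rewrite (_ : `|I| * _ = `|I| + N ^+ 2 * (w ^+ 2 * `|I|)); last by ring.
rewrite (_ : N ^+ 3 = N ^+ 2 * N); last by rewrite exprSr.
lra.
Qed.

End one_dim.



(** * Fubini's theorem and the Schur test *)

Section parametric_integrals.
Context d1 d2 (X : measurableType d1) (Y : measurableType d2) (R : realType).
Variables (m1 : {sigma_finite_measure set X -> \bar R}).
Variables (m2 : {sigma_finite_measure set Y -> \bar R}).

(** Tonelli makes the integrals of the positive and of the negative part measurable in x. Their
    difference, and [fine] of it, stay measurable even across points where the slice is not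
    integrable. *)
Lemma measurable_Rintegral_param (F : X * Y -> R) :
  measurable_fun setT F ->
  measurable_fun setT (fun x => \int[m2]_y F (x, y)).
Proof.
move=> mF; have mEF : measurable_fun setT (EFin \o F) by exact/measurable_EFinP.
apply: measurableT_comp => //.
rewrite (_ : (fun x => _) = fun x =>
    (\int[m2]_y (EFin \o F)^\+ (x, y) - \int[m2]_y (EFin \o F)^\- (x, y))%E).
  apply: emeasurable_funB.
    apply: (measurable_fun_fubini_tonelli_F (EFin \o F)^\+%E) => //.
    exact: measurable_funepos.
  apply: (measurable_fun_fubini_tonelli_F (EFin \o F)^\-%E) => //.
  exact: measurable_funeneg.
apply/funext => x; rewrite integralE.
by congr (_ - _)%E; apply: eq_integral => y _; rewrite ?funeposE ?funenegE.
Qed.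

Lemma Rintegral_abs_le (f : X -> R) : measurable_fun setT f ->
  ((`|\int[m1]_x f x|)%:E <= \int[m1]_x (`|f x|)%:E)%E.
Proof.
move=> mf; have mEf : measurable_fun setT (EFin \o f) by exact/measurable_EFinP.
apply: le_trans (le_abse_integral m1 measurableT mEf).
rewrite /Rintegral /comp.
(* An infinite integral is sent to 0 by [fine], so the bound survives. *)
by case: (integral _ _ _) => [r||]/=; rewrite ?normr0 ?leey.
Qed.

Variables (F : X * Y -> R) (a : X -> R) (b : Y -> R).
Hypothesis mF : measurable_fun setT F.
Hypothesis ia : m1.-integrable setT (EFin \o a).
Hypothesis ib : m2.-integrable setT (EFin \o b).
Hypothesis Fab : forall x y, `|F (x, y)| <= `|a x * b y|.

Let measurable_slice1 x : measurable_fun setT (fun y => F (x, y)).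
Proof. by apply: measurableT_comp mF _; exact: measurable_pair1. Qed.

Let measurable_slice2 y : measurable_fun setT (fun x => F (x, y)).
Proof. by apply: measurableT_comp mF _; exact: measurable_pair2. Qed.

Lemma integrable_slice1 x : m2.-integrable setT (fun y => (F (x, y))%:E).
Proof.
apply: (le_integrable _ _ _ (integrableZl measurableT (a x) ib)) => //.
  exact/measurable_EFinP.
by move=> y _ /=; rewrite lee_fin.
Qed.

Lemma integrable_slice2 y : m1.-integrable setT (fun x => (F (x, y))%:E).
Proof.
apply: (le_integrable _ _ _ (integrableZl measurableT (b y) ia)) => //.
  exact/measurable_EFinP.
by move=> x _ /=; rewrite lee_fin [b y * _]mulrC.
Qed.

Lemma integrable_prod_dom : (m1 \x m2)%E.-integrable setT (EFin \o F).
Proof.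
apply/integrable12ltyP; first exact/measurable_EFinP.
have mb : measurable_fun setT b by apply/measurable_EFinP; exact: measurable_int ib.
have ma : measurable_fun setT a by apply/measurable_EFinP; exact: measurable_int ia.
apply: (@le_lt_trans _ _
    (\int[m1]_x ((`|a x|)%:E * \int[m2]_y (`|b y|)%:E))%E).
  apply: ge0_le_integral => //.
  - by move=> x _; apply: integral_ge0.
  - apply: (measurable_fun_fubini_tonelli_F (abse \o (EFin \o F))) => //=.
    by apply: measurableT_comp => //; exact/measurable_EFinP.
  - apply: emeasurable_funM => //.
    by apply/measurable_EFinP; exact: measurableT_comp.
  - move=> x _; rewrite -ge0_integralZl//; last first.
      by apply/measurable_EFinP; exact: measurableT_comp.
    apply: ge0_le_integral => //.
    + by apply/measurable_EFinP; apply: measurableT_comp => //.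
    + by apply: emeasurable_funM => //; apply/measurable_EFinP; exact: measurableT_comp.
    + by move=> y _; rewrite -EFinM lee_fin -normrM.
have /integrableP[_ Ib] := ib; have /integrableP[_ Ia] := ia.
rewrite ge0_integralZr//; last 2 first.
- by apply/measurable_EFinP; exact: measurableT_comp.
- by apply: integral_ge0 => y _; rewrite lee_fin.
apply: lte_mul_pinfty => //; first exact: integral_ge0.
by rewrite ge0_fin_numE//; exact: integral_ge0.
Qed.

(** The bound by a product [a x * b y] makes every slice integrable, not just almost every one, so
    the inner integrals are finite at every point and [fine] can be removed there before Fubini's
    theorem is applied. *)
Lemma Rfubini_dom :
  \int[m1]_x \int[m2]_y F (x, y) = \int[m2]_y \int[m1]_x F (x, y).
Proof.
rewrite /Rintegral; congr fine.
under eq_integral => x _ do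
  rewrite fineK ?(integrable_fin_num _ (integrable_slice1 x))//.
under [RHS]eq_integral => y _ do
  rewrite fineK ?(integrable_fin_num _ (integrable_slice2 y))//.
exact: (Fubini integrable_prod_dom).
Qed.

End parametric_integrals.

Section schur.
Context d (T : measurableType d) (R : realType).
Variable (mu : {sigma_finite_measure set T -> \bar R}).
Local Open Scope ereal_scope.

(** The inequality |f x| |f y| <= (f x ^ 2 + f y ^ 2) / 2 splits the form into two halves. The row
    bound applies to the first at once, and to the second after Tonelli and the symmetry of [k]. *)
Lemma schur_test (k : T * T -> R) (M : R) (f : T -> R) :
  measurable_fun setT k -> measurable_fun setT f ->
  (forall p, 0 <= k p)%R -> (forall x y, k (x, y) = k (y, x)) ->
  (forall x, \int[mu]_y (k (x, y))%:E <= M%:E) -> (0 <= M)%R ->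
  \int[mu]_x \int[mu]_y (`|f x| * `|f y| * k (x, y))%:E <=
  M%:E * \int[mu]_x (f x ^+ 2)%:E.
Proof.
move=> mk mf k0 ksym kM M0.
have mfk1 : measurable_fun setT (fun p : T * T => f p.1 ^+ 2 * k p)%R.
  apply: measurable_funM => //; apply: measurable_funX.
  exact: measurableT_comp.
have mfk2 : measurable_fun setT (fun p : T * T => f p.2 ^+ 2 * k p)%R.
  apply: measurable_funM => //; apply: measurable_funX.
  exact: measurableT_comp.
have I1 : \int[mu]_x \int[mu]_y (f x ^+ 2 * k (x, y))%:E <=
    M%:E * \int[mu]_x (f x ^+ 2)%:E.
  rewrite -ge0_integralZl//; last 2 first.
  - by apply/measurable_EFinP; exact: measurable_funX.
  - by move=> x _; rewrite lee_fin sqr_ge0.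
  apply: ge0_le_integral => //.
  - by move=> x _; apply: integral_ge0 => y _; rewrite lee_fin mulr_ge0// sqr_ge0.
  - apply: (measurable_fun_fubini_tonelli_F
      (fun p : T * T => (f p.1 ^+ 2 * k p)%:E)) => //.
      exact/measurable_EFinP.
    by move=> p; rewrite lee_fin mulr_ge0// sqr_ge0.
  - by apply: emeasurable_funM => //; apply/measurable_EFinP; exact: measurable_funX.
  - move=> x _; under eq_integral do rewrite EFinM.
    rewrite ge0_integralZl ?lee_fin ?sqr_ge0//; last 2 first.
    + apply/measurable_EFinP.
      exact: (measurableT_comp mk (measurable_pair1 x)).
    + by move=> y _; rewrite lee_fin.
    by rewrite muleC lee_wpmul2r// lee_fin sqr_ge0.
have I2 : \int[mu]_x \int[mu]_y (f y ^+ 2 * k (x, y))%:E <=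
    M%:E * \int[mu]_x (f x ^+ 2)%:E.
  rewrite (fubini_tonelli (fun p : T * T => (f p.2 ^+ 2 * k p)%:E)) /=.
  - by under eq_integral do under eq_integral do rewrite ksym.
  - exact/measurable_EFinP.
  - by move=> p; rewrite lee_fin mulr_ge0// sqr_ge0.
have mS (p : T * T -> R) : measurable_fun setT p -> (forall z, 0 <= p z)%R ->
    measurable_fun setT (fun x => \int[mu]_y (p (x, y))%:E).
  move=> mp p0; apply: (measurable_fun_fubini_tonelli_F (EFin \o p)) => //.
  exact/measurable_EFinP.
have k1 z : (0 <= f z.1 ^+ 2 * k z)%R by rewrite mulr_ge0// sqr_ge0.
have k2 z : (0 <= f z.2 ^+ 2 * k z)%R by rewrite mulr_ge0// sqr_ge0.
apply: (@le_trans _ _ (\int[mu]_x ((2^-1)%:E *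
    (\int[mu]_y (f x ^+ 2 * k (x, y))%:E + \int[mu]_y (f y ^+ 2 * k (x, y))%:E)))).
  apply: ge0_le_integral => //.
  - by move=> x _; apply: integral_ge0 => y _; rewrite lee_fin !mulr_ge0.
  - apply: (measurable_fun_fubini_tonelli_F
      (fun p : T * T => (`|f p.1| * `|f p.2| * k p)%:E)) => //.
      apply/measurable_EFinP; apply: measurable_funM => //.
      by apply: measurable_funM => //; apply: measurableT_comp => //;
        exact: measurableT_comp.
    by move=> p; rewrite lee_fin !mulr_ge0.
  - apply: emeasurable_funM => //; apply: emeasurable_funD.
      exact: (mS (fun p => f p.1 ^+ 2 * k p)%R).
    exact: (mS (fun p => f p.2 ^+ 2 * k p)%R).
  - move=> x _; rewrite -ge0_integralD//; first last.
    + apply/measurable_EFinP.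
      exact: (measurableT_comp mfk2 (measurable_pair1 x)).
    + by move=> y _; rewrite lee_fin (k2 (x, y)).
    + apply/measurable_EFinP.
      exact: (measurableT_comp mfk1 (measurable_pair1 x)).
    + by move=> y _; rewrite lee_fin (k1 (x, y)).
    rewrite -ge0_integralZl//; first last.
    + by move=> y _; rewrite -EFinD lee_fin addr_ge0// (k1 (x,y), k2 (x,y)).
    + apply: emeasurable_funD; apply/measurable_EFinP.
        exact: (measurableT_comp mfk1 (measurable_pair1 x)).
      exact: (measurableT_comp mfk2 (measurable_pair1 x)).
    apply: ge0_le_integral => //.
    + by move=> y _; rewrite lee_fin !mulr_ge0.
    + apply/measurable_EFinP; apply: measurable_funM => //; last first.
        exact: (measurableT_comp mk (measurable_pair1 x)).
      by apply: measurable_funM => //; exact: measurableT_comp.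
    + apply: emeasurable_funM => //; apply: emeasurable_funD; apply/measurable_EFinP.
        exact: (measurableT_comp mfk1 (measurable_pair1 x)).
      exact: (measurableT_comp mfk2 (measurable_pair1 x)).
    + move=> y _; rewrite -EFinD -EFinM lee_fin -mulrDl mulrA ler_wpM2r//.
      have := sqr_ge0 (`|f x| - `|f y|)%R.
      rewrite -(real_normK (num_real (f x))) -(real_normK (num_real (f y))).
      rewrite sqrrB; lra.
rewrite ge0_integralZl ?lee_fin//; first last.
- by move=> x _; apply: adde_ge0; apply: integral_ge0 => y _;
    rewrite lee_fin (k1 (x, y), k2 (x, y)).
- apply: emeasurable_funD.
    exact: (mS (fun p => f p.1 ^+ 2 * k p)%R).
  exact: (mS (fun p => f p.2 ^+ 2 * k p)%R).
rewrite ge0_integralD//; first last.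
- exact: (mS (fun p => f p.2 ^+ 2 * k p)%R).
- by move=> x _; apply: integral_ge0 => y _; rewrite lee_fin (k2 (x, y)).
- exact: (mS (fun p => f p.1 ^+ 2 * k p)%R).
- by move=> x _; apply: integral_ge0 => y _; rewrite lee_fin (k1 (x, y)).
set Q := M%:E * _ in I1 I2 *.
apply: (@le_trans _ _ ((2^-1)%:E * (Q + Q))); first by rewrite lee_wpmul2l ?lee_fin// leeD.
have : 0 <= Q.
  by rewrite mule_ge0 ?lee_fin// integral_ge0// => x _; rewrite lee_fin sqr_ge0.
(* [Q] can be infinite, as [f] is merely measurable. *)
case: Q {I1 I2} => [r||] // _; last by rewrite leey.
by rewrite -EFinD -EFinM lee_fin; lra.
Qed.

End schur.



(** * L^2 bounds for cosine and sine transforms *)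

Section trig_transform.
Context (R : realType).
Notation mu := (@lebesgue_measure R).
Notation RR := (measurableTypeR R).

Definition trig (b : bool) : R -> R := if b then cos else sin.

Lemma trig_le1 b x : `|trig b x| <= 1.
Proof. by case: b; [exact: cos_max|exact: sin_max]. Qed.

Lemma measurable_trig b : measurable_fun setT (trig b).
Proof.
by case: b; apply: continuous_measurable_fun;
  [exact: continuous_cos|exact: continuous_sin].
Qed.

Lemma trigM b x y :
  trig b x * trig b y = (cos (x - y) + (-1) ^+ (~~ b) * cos (x + y)) / 2.
Proof. by case: b; rewrite /= cosB cosD; field. Qed.

Definition trig_transform b (f : RR -> R) (y : RR) : R :=
  \int[mu]_w (trig b (w * y) * f w).

Lemma measurable_trig_transform b (f : RR -> R) : measurable_fun setT f ->
  measurable_fun setT (trig_transform b f).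
Proof.
move=> mf; apply: (measurable_Rintegral_param mu
  (F := fun p : RR * RR => trig b (p.2 * p.1) * f p.2)).
apply: measurable_funM; last exact: measurableT_comp.
apply: measurableT_comp; first exact: measurable_trig.
exact: measurable_funM.
Qed.

Lemma integrable_le1M d (T : measurableType d) (m : {measure set T -> \bar R})
    (g h : T -> R) : measurable_fun setT g -> (forall x, `|g x| <= 1) ->
  m.-integrable setT (EFin \o h) -> m.-integrable setT (fun x => (g x * h x)%:E).
Proof.
move=> mg g1 ih.
have mh : measurable_fun setT h by apply/measurable_EFinP; exact: measurable_int ih.
apply: (le_integrable _ _ _ ih) => //.
  by apply/measurable_EFinP; exact: measurable_funM.
by move=> x _ /=; rewrite lee_fin normrM ler_piMl.
Qed.

Definition window (N : R) := (fun y => N ^+ 2 - y ^+ 2) \_ `[- N, N].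

Lemma integrable_window N : mu.-integrable setT (EFin \o window N).
Proof.
rewrite /window -restrict_EFin; apply: (iffLR (integrable_mkcond _ _)) => //.
apply: continuous_compact_integrable; first exact: segment_compact.
apply: continuous_subspaceT => y.
by apply: cvgB; [exact: cvg_cst|exact: exprn_continuous].
Qed.

Lemma window_ge0 N y : 0 <= window N y.
Proof.
rewrite /window patchE; case: ifPn => //; rewrite inE /= in_itv /= => /andP[y1 y2].
have N0 : 0 <= N by lra.
rewrite subr_ge0 -ler_sqrt ?sqr_ge0// !sqrtr_sqr (ger0_norm N0) ler_norml y1//.
Qed.

(** The 10 N^3 of [window_cos], halved by the product formula [trigM], at the two frequencies w' - w
    and w' + w. The sum is written [p.2 - (- p.1)] to fit [integral_cauchy_kernel] with centre
    [- p.1]. *)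
Definition trig_kernel (N : R) (p : RR * RR) := 5 * N ^+ 3 *
  ((1 + N ^+ 2 * (p.2 - p.1) ^+ 2)^-1 + (1 + N ^+ 2 * (p.2 - (- p.1)) ^+ 2)^-1).

Let measurable_cauchy d (T : measurableType d) N (g : T -> R) :
  measurable_fun setT g ->
  measurable_fun setT (fun t => (1 + N ^+ 2 * g t ^+ 2)^-1).
Proof.
move=> mg.
suff mf : measurable_fun setT (fun z : R => (1 + N ^+ 2 * z ^+ 2)^-1).
  exact: (measurableT_comp mf mg).
apply: continuous_measurable_fun => z; apply: cvgV.
  by rewrite gt_eqF// ltr_pwDl// mulr_ge0// sqr_ge0.
apply: cvgD; first exact: cvg_cst.
by apply: cvgM; [exact: cvg_cst|exact: exprn_continuous].
Qed.

Lemma measurable_trig_kernel N : measurable_fun setT (trig_kernel N).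
Proof.
apply: measurable_funM => //; apply: measurable_funD; apply: measurable_cauchy.
  exact: measurable_funB.
apply: measurable_funB => //; exact: measurableT_comp.
Qed.

Lemma trig_kernel_ge0 N p : 0 < N -> 0 <= trig_kernel N p.
Proof.
move=> N0; rewrite /trig_kernel mulr_ge0// ?mulr_ge0 ?exprn_ge0 ?ltW//.
by rewrite addr_gt0// invr_gt0 ltr_pwDl// mulr_ge0// sqr_ge0.
Qed.

Lemma integral_trig_kernel N x : 0 < N ->
  (\int[mu]_y (trig_kernel N (x, y))%:E <= (10 * N ^+ 2 * pi)%:E)%E.
Proof.
move=> N0; under eq_integral do rewrite /= EFinM EFinD.
have mk c : measurable_fun setT (fun y : RR => (1 + N ^+ 2 * (y - c) ^+ 2)^-1).
  exact/measurable_cauchy/measurable_funB.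
have k0 (c y : R) : 0 <= (1 + N ^+ 2 * (y - c) ^+ 2)^-1.
  by rewrite invr_ge0 addr_ge0// mulr_ge0// sqr_ge0.
rewrite ge0_integralZl//; first last.
- by rewrite lee_fin mulr_ge0// exprn_ge0// ltW.
- by move=> y _; rewrite -EFinD lee_fin addr_ge0.
- apply: emeasurable_funD; apply/measurable_EFinP.
    exact: (mk x).
  exact: (mk (- x)).
rewrite ge0_integralD//; first last.
- by apply/measurable_EFinP; exact: (mk (- x)).
- by move=> y _; rewrite lee_fin.
- by apply/measurable_EFinP; exact: (mk x).
- by move=> y _; rewrite lee_fin.
(* Each summand has mass at most [pi / N], and 5 N^3 times 2 pi / N is 10 N^2 pi. *)
apply: (@le_trans _ _ ((5 * N ^+ 3)%:E * ((pi / N)%:E + (pi / N)%:E))%E).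
  apply: lee_wpmul2l; first by rewrite lee_fin mulr_ge0// exprn_ge0// ltW.
  by apply: leeD; [exact: (@integral_cauchy_kernel R N x N0)|
    exact: (@integral_cauchy_kernel R N (- x) N0)].
rewrite -EFinD -EFinM lee_fin le_eqVlt; apply/orP; left; apply/eqP.
by field; rewrite gt_eqF.
Qed.

(** By [trigM] the integral is half a sum or difference of two cosine transforms of the window. The
    sign that tells cosine from sine disappears under absolute values. *)
Lemma window_trigM b N x y : 0 < N ->
  `|\int[mu]_t (window N t * (trig b (x * t) * trig b (y * t)))| <=
  trig_kernel N (x, y).
Proof.
move=> N0.
have ic (w : R) : mu.-integrable `[- N, N]
    (EFin \o (fun t => (N ^+ 2 - t ^+ 2) * cos (w * t))).
  apply: continuous_compact_integrable; first exact: segment_compact.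
  apply: continuous_subspaceT => s; apply: cvgM.
    by apply: cvgB; [exact: cvg_cst|exact: exprn_continuous].
  apply: (@continuous_comp _ _ _ (fun s => w * s) (@cos R)).
    by apply: cvgM; [exact: cvg_cst|].
  exact: continuous_cos.
have mD : measurable ([set` `[- N, N]] : set (measurableTypeR R)).
  exact: measurable_itv.
have icZ (c w : R) : mu.-integrable `[- N, N]
    (EFin \o (fun t => c * ((N ^+ 2 - t ^+ 2) * cos (w * t)))).
  exact: (integrableZl mD c (ic w)).
have icD (w1 c w : R) : mu.-integrable `[- N, N]
    (EFin \o (fun t => (N ^+ 2 - t ^+ 2) * cos (w1 * t) +
      c * ((N ^+ 2 - t ^+ 2) * cos (w * t)))).
  exact: (integrableD mD (ic w1) (icZ c w)).
have -> : \int[mu]_t (window N t * (trig b (x * t) * trig b (y * t))) =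
  2^-1 * (\int[mu]_(t in `[- N, N]) ((N ^+ 2 - t ^+ 2) * cos ((y - x) * t)) +
  (-1) ^+ (~~ b) * \int[mu]_(t in `[- N, N]) ((N ^+ 2 - t ^+ 2) * cos ((y - - x) * t))).
  rewrite -RintegralZl//.
  rewrite -RintegralD//.
  rewrite -RintegralZl//.
  rewrite [RHS]Rintegral_mkcond; apply: eq_Rintegral => t _.
  rewrite /window !patchE; case: ifPn => _; last by rewrite mul0r.
  have -> : (y - x) * t = - (x * t - y * t) by ring.
  have -> : (y - - x) * t = x * t + y * t by ring.
  by rewrite trigM cosN; field.
have := window_cos (y - x) N0; have := window_cos (y - - x) N0.
rewrite /trig_kernel /=.
set A := Rintegral _ _ _; set B := Rintegral _ _ _ => hA hB.
have h2 : 0 <= 2^-1 :> R by rewrite invr_ge0.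
rewrite normrM (ger0_norm h2).
have := ler_normD B ((-1) ^+ (~~ b) * A).
rewrite normrM normrX normrN1 expr1n mul1r.
lra.
Qed.

End trig_transform.



Section trig_transform_L2.
Context (R : realType).
Notation mu := (@lebesgue_measure R).
Notation RR := (measurableTypeR R).
Variables (b : bool) (f : RR -> R).
Hypothesis intf : mu.-integrable setT (EFin \o f).

Let mf : measurable_fun setT f.
Proof. by apply/measurable_EFinP; exact: measurable_int intf. Qed.

Let T := trig_transform b f.

Let mT : measurable_fun setT T. Proof. exact: measurable_trig_transform. Qed.

(** Boundedness allows [T] itself as the factor [g] of [window_swap], and makes the integral of the
    window times T^2 finite. *)
Lemma trig_transform_bounded y : `|T y| <= \int[mu]_w `|f w|.
Proof.
have mtf : measurable_fun setT (fun w : RR => trig b (w * y) * f w).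
  apply: measurable_funM => //; apply: measurableT_comp.
    exact: measurable_trig.
  exact: measurable_funM.
have itf : mu.-integrable setT (fun w : RR => (trig b (w * y) * f w)%:E).
  apply: integrable_le1M => //; last by move=> w; exact: trig_le1.
  apply: measurableT_comp; first exact: measurable_trig.
  exact: measurable_funM.
apply: (le_trans (le_normr_Rintegral measurableT itf)).
apply: le_Rintegral => //.
- exact: integrable_norm itf.
- exact: integrable_norm intf.
- by move=> w _; rewrite normrM ler_piMl// trig_le1.
Qed.

Let W (N : R) : RR -> R := @window R N.

(** Fubini, dominated by the integrable product of c times the window with [f]. It is applied once
    for each factor of [T ^+ 2]: first with [g := T], then with [g] a single cosine or sine. *)
Let window_swap (N c : R) (g : RR -> R) : measurable_fun setT g ->
  (forall y, `|g y| <= c) ->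
  \int[mu]_y (W N y * g y * T y) =
  \int[mu]_w (f w * \int[mu]_y (W N y * (g y * trig b (w * y)))).
Proof.
move=> mg gc.
pose F (p : RR * RR) := W N p.1 * g p.1 * (trig b (p.2 * p.1) * f p.2).
have mW : measurable_fun setT (W N).
  by apply/measurable_EFinP; exact: measurable_int (integrable_window N).
have mF : measurable_fun setT F.
  apply: measurable_funM.
    by apply: measurable_funM; exact: measurableT_comp.
  apply: measurable_funM; last exact: measurableT_comp.
  apply: measurableT_comp; first exact: measurable_trig.
  exact: measurable_funM.
have iW : mu.-integrable setT (EFin \o (fun y => c * W N y)).
  exact: (integrableZl measurableT c (integrable_window N)).
have FD x y : `|F (x, y)| <= `|c * W N x * f y|.
  rewrite /F /= !normrM mulrA ler_wpM2r// -[leRHS]mulr1 ler_pM ?mulr_ge0//.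
    rewrite mulrC ler_wpM2r//; apply: le_trans (gc x) _; exact: ler_norm.
  exact: trig_le1.
transitivity (\int[mu]_y \int[mu]_w F (y, w)).
  apply: eq_Rintegral => y _; rewrite /F /= RintegralZl//.
  apply: integrable_le1M => //; last by move=> w; exact: trig_le1.
  apply: measurableT_comp; first exact: measurable_trig.
  exact: measurable_funM.
rewrite (Rfubini_dom mF iW intf FD).
apply: eq_Rintegral => w _; rewrite -RintegralZl//.
  by apply: eq_Rintegral => y _; rewrite /F /=; ring.
apply: (le_integrable _ _ _ iW) => //.
  apply/measurable_EFinP; apply: measurable_funM => //.
  apply: measurable_funM => //; apply: measurableT_comp.
    exact: measurable_trig.
  exact: measurable_funM.
move=> y _ /=; rewrite lee_fin !normrM mulrC ler_wpM2r//.
rewrite -[leRHS]mulr1 ler_pM//; last exact: trig_le1.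
by apply: le_trans (gc y) _; exact: ler_norm.
Qed.

Let window_energy (N : R) : 0 < N ->
  ((\int[mu]_y (W N y * T y ^+ 2))%:E <=
  (10 * N ^+ 2 * pi)%:E * \int[mu]_x (f x ^+ 2)%:E)%E.
Proof.
move=> N0.
have N20 : 0 <= 10 * N ^+ 2 * pi by rewrite !mulr_ge0 ?exprn_ge0 ?pi_ge0// ltW.
pose A (w w' : RR) := \int[mu]_y (W N y * (trig b (w * y) * trig b (w' * y))).
have mW : measurable_fun setT (W N).
  by apply/measurable_EFinP; exact: measurable_int (integrable_window N).
have mA : measurable_fun setT (fun p : RR * RR => A p.1 p.2).
  apply: (measurable_Rintegral_param mu (F := fun q : (RR * RR) * RR =>
    W N q.2 * (trig b (q.1.1 * q.2) * trig b (q.1.2 * q.2)))).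
  apply: measurable_funM; first exact: measurableT_comp.
  have h (g : RR * RR -> R) : measurable_fun setT g ->
      measurable_fun setT (fun q : (RR * RR) * RR => trig b (g q.1 * q.2)).
    move=> mg; apply: measurableT_comp; first exact: measurable_trig.
    by apply: measurable_funM => //; exact: measurableT_comp.
  by apply: measurable_funM; [exact: (h fst)|exact: (h snd)].
have -> : \int[mu]_y (W N y * T y ^+ 2) =
    \int[mu]_w (f w * \int[mu]_w' (f w' * A w w')).
  under eq_Rintegral do rewrite expr2 mulrA.
  rewrite (window_swap N mT trig_transform_bounded).
  apply: eq_Rintegral => w _; congr (_ * _).
  under eq_Rintegral do rewrite [T _ * _]mulrC mulrA.
  apply: (window_swap N (c := 1)); last by move=> y; exact: trig_le1.
  apply: measurableT_comp; first exact: measurable_trig.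
  exact: measurable_funM.
have mfA w : measurable_fun setT (fun w' => f w' * A w w').
  apply: measurable_funM => //.
  exact: (measurableT_comp mA (measurable_pair1 w)).
have k0 p : 0 <= trig_kernel N p by exact: trig_kernel_ge0.
have ksym (x y : RR) : trig_kernel N (x, y) = trig_kernel N (y, x).
  rewrite /trig_kernel /= -[(y - x) ^+ 2]sqrrN opprB.
  by rewrite !opprK [y + x]addrC.
apply: (le_trans _ (schur_test (measurable_trig_kernel N) mf k0 ksym
  (fun x => integral_trig_kernel x N0) N20)).
have mfB : measurable_fun setT (fun w => f w * \int[mu]_w' (f w' * A w w')).
  apply: measurable_funM => //.
  apply: (measurable_Rintegral_param mu (F := fun p : RR * RR => f p.2 * A p.1 p.2)).
  by apply: measurable_funM => //; exact: measurableT_comp.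
apply: (@le_trans _ _ (`|\int[mu]_w (f w * \int[mu]_w' (f w' * A w w'))|%:E)%E).
  by rewrite lee_fin ler_norm.
apply: (le_trans (Rintegral_abs_le mu mfB)).
apply: ge0_le_integral => //.
- by apply/measurable_EFinP; exact: measurableT_comp.
- apply: (measurable_fun_fubini_tonelli_F
    (fun p : RR * RR => (`|f p.1| * `|f p.2| * trig_kernel N p)%:E)) => //.
    apply/measurable_EFinP; apply: measurable_funM; last exact: measurable_trig_kernel.
    by apply: measurable_funM => //; apply: measurableT_comp => //;
        exact: measurableT_comp.
  by move=> p; rewrite lee_fin; apply: mulr_ge0 => //; exact: mulr_ge0.
- move=> w _; rewrite normrM EFinM.
  under eq_integral do rewrite -mulrA EFinM.
  rewrite ge0_integralZl//; last 2 first.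
  + apply/measurable_EFinP; apply: measurable_funM; first exact: measurableT_comp.
    exact: (measurableT_comp (measurable_trig_kernel N) (measurable_pair1 w)).
  + by move=> y _; rewrite lee_fin; exact: mulr_ge0.
  apply: lee_wpmul2l => //; apply: (le_trans (Rintegral_abs_le mu (mfA w))).
  apply: ge0_le_integral => //.
  + by apply/measurable_EFinP; exact: measurableT_comp.
  + apply/measurable_EFinP; apply: measurable_funM; first exact: measurableT_comp.
    exact: (measurableT_comp (measurable_trig_kernel N) (measurable_pair1 w)).
  + move=> y _; rewrite lee_fin normrM ler_wpM2l//.
    exact: window_trigM.
Qed.

(** With N = 2 n the window is at least 4 n^2 - n^2 = 3 n^2 on [-n, n]. Dividing the energy bound 10
    N^2 pi = 40 n^2 pi by this leaves a constant independent of n. *)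
Lemma trig_transform_L2 :
  (\int[mu]_y (T y ^+ 2)%:E <=
    (40 / 3 * pi)%:E * \int[mu]_x (f x ^+ 2)%:E)%E.
Proof.
apply: ge0_integral_le_segments.
- exact: measurable_funX.
- by move=> x; exact: sqr_ge0.
move=> n n0.
set N : R := 2 * n%:R.
have n0' : 0 < n%:R :> R by rewrite ltr0n.
have N0 : 0 < N by rewrite mulr_gt0.
have c0 : 0 < 3 * n%:R ^+ 2 :> R by rewrite mulr_gt0// exprn_gt0.
have cE : 3 * n%:R ^+ 2 * (40 / 3 * pi) = 10 * N ^+ 2 * pi by rewrite /N; field.
have mT2 : measurable_fun setT (fun y => T y ^+ 2) by exact: measurable_funX.
have mW : measurable_fun setT (W N).
  by apply/measurable_EFinP; exact: measurable_int (integrable_window N).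
have W0 y : 0 <= W N y by exact: window_ge0.
have mWT : measurable_fun setT (fun y => W N y * T y ^+ 2) by exact: measurable_funM.
rewrite -(@lee_pmul2l _ (3 * n%:R ^+ 2)%:E)//.
rewrite muleA -EFinM cE; apply: le_trans (window_energy N0).
rewrite /Rintegral fineK; last first.
  apply: (integrable_fin_num measurableT).
  have iW := integrableZl measurableT ((\int[mu]_w `|f w|) ^+ 2) (integrable_window N).
  apply: (le_integrable _ _ _ iW) => //; first exact/measurable_EFinP.
  move=> y _ /=; rewrite lee_fin -/(W N y) mulrC normrM [leRHS]normrM ler_wpM2r//.
  rewrite !normrX lerXn2r ?nnegrE//.
  exact: le_trans (trig_transform_bounded y) (ler_norm _).
rewrite -ge0_integralZl ?lee_fin ?(ltW c0)//; last 2 first.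
- by apply/measurable_EFinP; exact: measurable_funS mT2.
- by move=> x _; rewrite lee_fin sqr_ge0.
rewrite integral_mkcond.
have mn : measurable ([set` `[- n%:R, n%:R]] : set RR) by exact: measurable_itv.
apply: ge0_le_integral => //.
- move=> y _; rewrite patchE; case: ifPn => // _.
  by rewrite -EFinM lee_fin mulr_ge0 ?sqr_ge0// ltW.
- apply: (iffLR (measurable_restrictT _ mn)).
  apply/measurable_EFinP; apply: measurable_funM => //.
  exact: measurable_funS mT2.
- exact/measurable_EFinP.
- move=> y _; rewrite patchE; case: ifPn => [|_]; last first.
    by rewrite lee_fin mulr_ge0 ?sqr_ge0.
  rewrite inE /= in_itv /= => /andP[y1 y2].
  rewrite -EFinM lee_fin ler_wpM2r ?sqr_ge0//.
  have yN : y \in [set` `[- N, N]].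
    by rewrite inE /= in_itv /= /N; apply/andP; split; lra.
  rewrite /W /window patchE yN /N.
  have : y ^+ 2 <= n%:R ^+ 2.
    by rewrite -ler_sqrt ?sqr_ge0// !sqrtr_sqr (gtr0_norm n0') ler_norml y1.
  rewrite exprMn; lra.
Qed.

End trig_transform_L2.



(** * Cosine and sine transforms in two variables *)

Section lebesgue2_sigma_finite.
Context (R : realType).
Notation RR := (measurableTypeR R).

(** Fubini's theorem and parametric measurability over pairs of points of the plane rest on this;
    growing squares exhaust the plane. *)
Let lebesgue2_sigma_finite : sigma_finite setT (@lebesgue2 R).
Proof.
pose F (n : nat) : set RR := `[- n.+1%:R, n.+1%:R]%classic.
have mF n : measurable (F n) by exact: measurable_itv.
exists (fun n => F n `*` F n).
  apply/seteqP; split => // -[x y] _.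
  exists (maxn (Num.truncn `|x|) (Num.truncn `|y|)) => //.
  by split; rewrite /F /= in_itv /= -ler_norml;
    apply/ltW/(lt_le_trans (Num.Theory.truncnS_gt _));
    rewrite ler_nat ltnS ?leq_maxl ?leq_maxr.
move=> n; split; first exact: measurableX.
rewrite [ltLHS](product_measure1E lebesgue_measure lebesgue_measure (mF n) (mF n)).
have F_fin : (lebesgue_measure (F n) < +oo)%E.
  rewrite /F lebesgue_measure_itv /= lte_fin gtrN ?ltr0n//.
  by rewrite ltry.
apply: lte_mul_pinfty => //.
by rewrite ge0_fin_numE//; exact: measure_ge0.
Qed.

HB.instance Definition _ := Measure_isSigmaFinite.Build _ _ _ (@lebesgue2 R)
  lebesgue2_sigma_finite.

End lebesgue2_sigma_finite.

Section trig_transform2.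
Context (R : realType).
Notation mu := (@lebesgue_measure R).
Notation RR := (measurableTypeR R).
Notation mu2 := (@lebesgue2 R).
Variables (a b : bool).

Definition trig2 (w y : RR * RR) : R := trig a (w.1 * y.1) * trig b (w.2 * y.2).

Lemma trig2_le1 w y : `|trig2 w y| <= 1.
Proof.
by rewrite normrM -[leRHS]mulr1 ler_pM// trig_le1.
Qed.

Lemma measurable_trig2 : measurable_fun setT
  (fun p : (RR * RR) * (RR * RR) => trig2 p.1 p.2).
Proof.
have h c (f g : (RR * RR) * (RR * RR) -> R) :
    measurable_fun setT f -> measurable_fun setT g ->
    measurable_fun setT (fun p => trig c (f p * g p)).
  move=> mf mg; apply: measurableT_comp; first exact: measurable_trig.
  exact: measurable_funM.
apply: measurable_funM; apply: h.
- exact: (measurableT_comp measurable_fst measurable_fst).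
- exact: (measurableT_comp measurable_fst measurable_snd).
- exact: (measurableT_comp measurable_snd measurable_fst).
- exact: (measurableT_comp measurable_snd measurable_snd).
Qed.

Variable (g : RR * RR -> R).
Hypothesis ig : mu2.-integrable setT (EFin \o g).

Let mg : measurable_fun setT g.
Proof. by apply/measurable_EFinP; exact: measurable_int ig. Qed.

Definition trig_transform2 (y : RR * RR) : R := \int[mu2]_w (trig2 w y * g w).

Lemma measurable_trig_transform2 : measurable_fun setT trig_transform2.
Proof.
pose F (p : (RR * RR) * (RR * RR)) := trig2 p.2 p.1 * g p.2.
suff mF : measurable_fun setT F by exact: (measurable_Rintegral_param mu2 mF).
apply: measurable_funM; last exact: measurableT_comp.
pose swap (p : (RR * RR) * (RR * RR)) := (p.2, p.1).
have mswap : measurable_fun setT swap by exact: measurable_fun_pair.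
exact: (measurableT_comp measurable_trig2 mswap).
Qed.

Let G (y1 w2 : RR) : R := trig_transform a (fun w1 => g (w1, w2)) y1.

Let mG : measurable_fun setT (fun p : RR * RR => G p.1 p.2).
Proof.
apply: (measurable_Rintegral_param mu (F := fun q : (RR * RR) * RR =>
    trig a (q.2 * q.1.1) * g (q.2, q.1.2))).
apply: measurable_funM.
  apply: measurableT_comp; first exact: measurable_trig.
  apply: measurable_funM => //.
  exact: (measurableT_comp measurable_fst measurable_fst).
apply: measurableT_comp => //; apply: measurable_fun_pair => //.
exact: (measurableT_comp measurable_snd measurable_fst).
Qed.

(** |G y1 w2| is at most the integral of |g(., w2)|, possibly infinite, and by Tonelli that is
    integrable in w2. Hence the one-variable bound is available for [G y1] at every [y1]. *)
Let iG y1 : mu.-integrable setT (EFin \o G y1).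
Proof.
have mGy : measurable_fun setT (G y1).
  exact: (measurableT_comp mG (measurable_pair1 y1)).
apply/integrableP; split; first exact/measurable_EFinP.
have h := (integrable21ltyP mu mu (measurable_int _ ig)).1 ig.
apply: le_lt_trans h; apply: ge0_le_integral => //.
- by apply/measurable_EFinP; exact: measurableT_comp.
- apply: (measurable_fun_fubini_tonelli_G (fun p => (`|g p|)%:E)).
    by apply/measurable_EFinP; exact: measurableT_comp.
  by move=> p; rewrite lee_fin.
move=> w2 _.
have mg2 : measurable_fun setT (fun w1 => g (w1, w2)).
  exact: (measurableT_comp mg (measurable_pair2 w2)).
have mtg : measurable_fun setT (fun w1 : RR => trig a (w1 * y1) * g (w1, w2)).
  apply: measurable_funM => //.
  apply: measurableT_comp; first exact: measurable_trig.
  exact: measurable_funM.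
apply: (le_trans (Rintegral_abs_le mu mtg)).
apply: ge0_le_integral => //.
- by apply/measurable_EFinP; exact: measurableT_comp.
- by apply/measurable_EFinP; exact: measurableT_comp.
- by move=> w1 _ /=; rewrite lee_fin normrM ler_piMl// trig_le1.
Qed.

Let trig_transform2E y : trig_transform2 y = trig_transform b (G y.1) y.2.
Proof.
have mt : measurable_fun setT (fun w => trig2 w y).
  exact: (measurableT_comp measurable_trig2 (measurable_pair2 y)).
have itg : mu2.-integrable setT (EFin \o (fun w => trig2 w y * g w)).
  by apply: integrable_le1M => // w; exact: trig2_le1.
rewrite /trig_transform2 /trig_transform /Rintegral.
rewrite -(integral21_prod_meas1 itg); congr fine.
(* Where the slice of [g] at w2 is not integrable, the value of [G] may be junk; such w2 form a null
   set. *)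
apply: ae_eq_integral_nonmeasurable.
apply: filterS (ae_integrable2 ig) => w2 /= ig2.
rewrite /fubini_G /=.
transitivity (\int[mu]_w1 ((trig b (w2 * y.2))%:E *
    (trig a (w1 * y.1) * g (w1, w2))%:E))%E.
  apply: eq_integral => w1 _; rewrite /trig2 /= -EFinM; congr EFin; ring.
have itg2 : mu.-integrable setT (fun w1 : RR => (trig a (w1 * y.1) * g (w1, w2))%:E).
  apply: integrable_le1M => //; last by move=> w; exact: trig_le1.
  apply: measurableT_comp; first exact: measurable_trig.
  exact: measurable_funM.
rewrite integralZl// EFinM /G /trig_transform /Rintegral fineK//.
exact: integrable_fin_num itg2.
Qed.

Let C : R := 40 / 3 * pi.

(** Each variable costs one factor [C]: the one-variable bound is used in the second variable on
    [G y1], then, after Tonelli, in the first variable on the slices of [g], which are integrable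
    for almost every w2. *)
Lemma trig_transform2_L2 :
  (\int[mu2]_y (trig_transform2 y ^+ 2)%:E <=
    (C ^+ 2)%:E * \int[mu2]_w (g w ^+ 2)%:E)%E.
Proof.
have C0 : 0 <= C by rewrite /C mulr_ge0// pi_ge0.
have sq0 (x : R) : (0 <= (x ^+ 2)%:E)%E by rewrite lee_fin sqr_ge0.
have mT2 : measurable_fun setT (fun y => (trig_transform2 y ^+ 2)%:E).
  by apply/measurable_EFinP; apply: measurable_funX; exact: measurable_trig_transform2.
have mg2 : measurable_fun setT (fun w => (g w ^+ 2)%:E).
  by apply/measurable_EFinP; exact: measurable_funX.
have mG2 : measurable_fun setT (fun p : RR * RR => (G p.1 p.2 ^+ 2)%:E).
  by apply/measurable_EFinP; exact: measurable_funX.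
rewrite fubini_tonelli1//.
apply: (@le_trans _ _ (\int[mu]_y1 (C%:E * \int[mu]_w2 (G y1 w2 ^+ 2)%:E))%E).
  apply: ge0_le_integral => //.
  - by move=> x _; exact: integral_ge0.
  - exact: measurable_fun_fubini_tonelli_F.
  - apply: emeasurable_funM => //.
    exact: (measurable_fun_fubini_tonelli_F (fun p : RR * RR => (G p.1 p.2 ^+ 2)%:E)).
  - move=> y1 _; rewrite /fubini_F.
    under eq_integral do rewrite trig_transform2E /=.
    exact: trig_transform_L2.
rewrite ge0_integralZl ?lee_fin//; first last.
- by move=> y1 _; exact: integral_ge0.
- exact: (measurable_fun_fubini_tonelli_F (fun p : RR * RR => (G p.1 p.2 ^+ 2)%:E)).
rewrite (fubini_tonelli (fun p : RR * RR => (G p.1 p.2 ^+ 2)%:E))//=.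
rewrite expr2 (EFinM C C) -(muleA C%:E C%:E); apply: lee_wpmul2l; first by rewrite lee_fin.
rewrite (fubini_tonelli2 (fun w => (g w ^+ 2)%:E))//.
have mS : measurable_fun setT (fun w2 => \int[mu]_w1 (g (w1, w2) ^+ 2)%:E)%E.
  exact: (measurable_fun_fubini_tonelli_G (fun w => (g w ^+ 2)%:E)).
rewrite -ge0_integralZl//; last first.
  by move=> y1 _; exact: integral_ge0.
apply: ae_ge0_le_integral => //.
- by move=> y1 _; exact: integral_ge0.
- exact: (measurable_fun_fubini_tonelli_G (fun p : RR * RR => (G p.1 p.2 ^+ 2)%:E)).
- by move=> y1 _; apply: mule_ge0 => //; exact: integral_ge0.
- exact: emeasurable_funM.
apply: filterS (ae_integrable2 ig) => w2 ig2 _.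
exact: (trig_transform_L2 a ig2).
Qed.

End trig_transform2.



(** * Quaternion-valued functions *)

Section quat_algebra.
Context (R : realType).
Implicit Types (p q : quat R) (t : R).

(* Every n >= 3 denotes the last component. *)
Definition qc (n : nat) (q : quat R) : R :=
  match n with 0 => q0 q | 1 => q1 q | 2 => q2 q | _ => q3 q end%N.

Lemma quat_ext p q : (forall n, qc n p = qc n q) -> p = q.
Proof.
case: p q => a b c d [a' b' c' d'] h.
by move: (h 0%N) (h 1%N) (h 2%N) (h 3%N) => /= -> -> -> ->.
Qed.

Lemma qcD n p q : qc n (p + q) = qc n p + qc n q.
Proof. by move: n => [|[|[|n]]]. Qed.

Lemma qcN n p : qc n (- p) = - qc n p.
Proof. by move: n => [|[|[|n]]]. Qed.

Lemma qcB n p q : qc n (p - q) = qc n p - qc n q.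
Proof. by rewrite qcD qcN. Qed.

Lemma qcZ n t p : qc n (t *: p) = t * qc n p.
Proof. by move: n => [|[|[|n]]]. Qed.

Lemma qc0 n : qc n 0 = 0.
Proof. by move: n => [|[|[|n]]]. Qed.

Lemma qc_sum n I (r : seq I) (P : pred I) (F : I -> quat R) :
  qc n (\sum_(i <- r | P i) F i) = \sum_(i <- r | P i) qc n (F i).
Proof. exact: (big_morph (qc n) (qcD n) (qc0 n)). Qed.

Lemma scaleq_mull t p q : (t *: p) * q = t *: (p * q).
Proof. by congr Quat; rewrite /=; ring. Qed.

Lemma scaleq_mulr t p q : p * (t *: q) = t *: (p * q).
Proof. by congr Quat; rewrite /=; ring. Qed.

Definition qnorm2 q : R := q0 q ^+ 2 + q1 q ^+ 2 + q2 q ^+ 2 + q3 q ^+ 2.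

Lemma qnorm2_ge0 q : 0 <= qnorm2 q.
Proof. by rewrite !addr_ge0// sqr_ge0. Qed.

Lemma qnorm2E q : qnorm q ^+ 2 = qnorm2 q.
Proof. by rewrite sqr_sqrtr// qnorm2_ge0. Qed.

Lemma qnorm_ge0 q : 0 <= qnorm q.
Proof. exact: sqrtr_ge0. Qed.

(** Euler's four-square identity. *)
Lemma qnormM p q : qnorm (p * q) = qnorm p * qnorm q.
Proof.
rewrite -[LHS]/(Num.sqrt (qnorm2 (p * q))) -[qnorm p]/(Num.sqrt (qnorm2 p)).
rewrite -sqrtrM ?qnorm2_ge0//; congr Num.sqrt.
by rewrite /qnorm2 /=; ring.
Qed.

Lemma qnormZ t q : qnorm (t *: q) = `|t| * qnorm q.
Proof.
rewrite -[LHS]/(Num.sqrt (qnorm2 (t *: q))) -sqrtr_sqr -sqrtrM ?sqr_ge0//.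
by congr Num.sqrt; rewrite /qnorm2 /=; ring.
Qed.

Lemma qnormN q : qnorm (- q) = qnorm q.
Proof. by congr Num.sqrt; rewrite /= !sqrrN. Qed.

Lemma sqr_qc_le n q : qc n q ^+ 2 <= qnorm2 q.
Proof.
rewrite /qnorm2; have := sqr_ge0 (q0 q); have := sqr_ge0 (q1 q).
have := sqr_ge0 (q2 q); have := sqr_ge0 (q3 q).
by move: n => [|[|[|n]]] /=; lra.
Qed.

Lemma qc_le n q : `|qc n q| <= qnorm q.
Proof. by rewrite -sqrtr_sqr ler_sqrt ?qnorm2_ge0// sqr_qc_le. Qed.

Lemma qnorm2_sum q : qnorm2 q = \sum_(n < 4) qc n q ^+ 2.
Proof. by rewrite !big_ord_recr big_ord0 /= add0r. Qed.

Lemma qnorm_le_sum q : qnorm q <= \sum_(n < 4) `|qc n q|.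
Proof.
have h : 0 <= \sum_(n < 4) `|qc n q| by exact: sumr_ge0.
rewrite -[leRHS](ger0_norm h) -sqrtr_sqr ler_sqrt ?sqr_ge0//.
rewrite !big_ord_recr big_ord0 /= add0r.
rewrite -(real_normK (num_real (q0 q))) -(real_normK (num_real (q1 q))).
rewrite -(real_normK (num_real (q2 q))) -(real_normK (num_real (q3 q))).
have := normr_ge0 (q0 q); have := normr_ge0 (q1 q).
have := normr_ge0 (q2 q); have := normr_ge0 (q3 q).
nra.
Qed.

Lemma qnorm2D_le p q : qnorm2 (p + q) <= 2 * qnorm2 p + 2 * qnorm2 q.
Proof.
have h (x y : R) : (x + y) ^+ 2 <= 2 * x ^+ 2 + 2 * y ^+ 2.
  by have := sqr_ge0 (x - y); rewrite sqrrB sqrrD; lra.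
have := h (q0 p) (q0 q); have := h (q1 p) (q1 q).
have := h (q2 p) (q2 q); have := h (q3 p) (q3 q).
rewrite /qnorm2 /=; lra.
Qed.

Lemma qnorm_eq0 q : (qnorm q == 0) = (q == 0).
Proof.
apply/idP/eqP => [|->]; last first.
  by apply/eqP; rewrite /qnorm /= expr0n /= !addr0 sqrtr0.
move=> /eqP q0; apply: quat_ext => n; rewrite qc0.
by apply/eqP; rewrite -normr_le0 -q0 qc_le.
Qed.

Let qi_double t m : (t *: qi) ^+ m.*2 = Quat ((-1) ^+ m * t ^+ m.*2) 0 0 0.
Proof.
elim: m => [|m IH]; first by congr Quat; rewrite /=; ring.
rewrite doubleS !exprS IH; move: (t ^+ _) ((-1) ^+ m) => x y.
by congr Quat; rewrite /=; ring.
Qed.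

Let qj_double t m : (t *: qj) ^+ m.*2 = Quat ((-1) ^+ m * t ^+ m.*2) 0 0 0.
Proof.
elim: m => [|m IH]; first by congr Quat; rewrite /=; ring.
rewrite doubleS !exprS IH; move: (t ^+ _) ((-1) ^+ m) => x y.
by congr Quat; rewrite /=; ring.
Qed.

Let parity (P : nat -> Prop) :
  (forall m, P m.*2) -> (forall m, P m.*2.+1) -> forall n, P n.
Proof.
move=> Pe Po n; rewrite -(odd_double_half n); case: odd.
  by rewrite add1n; exact: Po.
by rewrite add0n; exact: Pe.
Qed.

Lemma qexp_term_qi t k :
  (k`!%:R)^-1 *: (t *: qi) ^+ k = Quat (cos_coeff t k) (sin_coeff t k) 0 0.
Proof.
elim/parity: k => m.
  rewrite qi_double /cos_coeff /sin_coeff /= odd_double /= doubleK -exprnP.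
  move: (t ^+ _) ((-1) ^+ m) (_^-1) => x y z.
  by congr Quat; rewrite /=; ring.
rewrite exprS qi_double /cos_coeff /sin_coeff /= odd_double /= doubleK exprS.
move: (t ^+ _) ((-1) ^+ m) (_^-1) => x y z.
by congr Quat; rewrite /=; ring.
Qed.

Lemma qexp_term_qj t k :
  (k`!%:R)^-1 *: (t *: qj) ^+ k = Quat (cos_coeff t k) 0 (sin_coeff t k) 0.
Proof.
elim/parity: k => m.
  rewrite qj_double /cos_coeff /sin_coeff /= odd_double /= doubleK -exprnP.
  move: (t ^+ _) ((-1) ^+ m) (_^-1) => x y z.
  by congr Quat; rewrite /=; ring.
rewrite exprS qj_double /cos_coeff /sin_coeff /= odd_double /= doubleK exprS.
move: (t ^+ _) ((-1) ^+ m) (_^-1) => x y z.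
by congr Quat; rewrite /=; ring.
Qed.

Let limn_sum0 (F : nat -> quat R) n : (forall k, qc n (F k) = 0) ->
  limn (fun m => qc n (\sum_(0 <= k < m) F k)) = 0.
Proof.
move=> F0; under eq_fun do rewrite qc_sum big1 ?F0//.
exact: lim_cst.
Qed.

(** The partial sums of the components are term by term those whose limits define [cos] and [sin],
    so the limits agree without any convergence argument. *)
Lemma qexp_qi t : qexp (t *: qi) = Quat (cos t) (sin t) 0 0.
Proof.
rewrite /qexp /qlim; congr Quat.
- rewrite ?cos.unlock ?sin.unlock; apply: (congr1 (fun u : nat -> R => limn u)).
  apply/funext => n.
  apply: (etrans (qc_sum 0 _ _ _)); apply: eq_bigr => k _.
  by rewrite qexp_term_qi.
- rewrite ?cos.unlock ?sin.unlock; apply: (congr1 (fun u : nat -> R => limn u)).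
  apply/funext => n.
  apply: (etrans (qc_sum 1 _ _ _)); apply: eq_bigr => k _.
  by rewrite qexp_term_qi.
- by apply: (@limn_sum0 _ 2) => k; rewrite qexp_term_qi.
- by apply: (@limn_sum0 _ 3) => k; rewrite qexp_term_qi.
Qed.

Lemma qexp_qj t : qexp (t *: qj) = Quat (cos t) 0 (sin t) 0.
Proof.
rewrite /qexp /qlim; congr Quat.
- rewrite ?cos.unlock ?sin.unlock; apply: (congr1 (fun u : nat -> R => limn u)).
  apply/funext => n.
  apply: (etrans (qc_sum 0 _ _ _)); apply: eq_bigr => k _.
  by rewrite qexp_term_qj.
- by apply: (@limn_sum0 _ 1) => k; rewrite qexp_term_qj.
- rewrite ?cos.unlock ?sin.unlock; apply: (congr1 (fun u : nat -> R => limn u)).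
  apply/funext => n.
  apply: (etrans (qc_sum 2 _ _ _)); apply: eq_bigr => k _.
  by rewrite qexp_term_qj.
- by apply: (@limn_sum0 _ 3) => k; rewrite qexp_term_qj.
Qed.

End quat_algebra.



Section quat_measurability.
Context d (T : measurableType d) (R : realType).
Implicit Types f g : T -> quat R.

(** Set over an arbitrary measurable space, since kernels on pairs of points of the plane need it;
    on the plane it is [borel_measurable]. *)
Definition qmeas f := forall n, measurable_fun setT (fun x => qc n (f x)).

Lemma qmeasM f g : qmeas f -> qmeas g -> qmeas (fun x => f x * g x).
Proof.
move=> mf mg; have h i j := measurable_funM (mf i) (mg j).
move=> [|[|[|n]]] /=.
- exact: measurable_funB (measurable_funB (measurable_funB (h 0 0) (h 1 1)) (h 2 2)) (h 3 3).
- exact: measurable_funB (measurable_funD (measurable_funD (h 0 1) (h 1 0)) (h 2 3)) (h 3 2).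
- exact: measurable_funD (measurable_funD (measurable_funB (h 0 2) (h 1 3)) (h 2 0)) (h 3 1).
- exact: measurable_funD (measurable_funB (measurable_funD (h 0 3) (h 1 2)) (h 2 1)) (h 3 0).
Qed.

Lemma qmeas_cst q : qmeas (fun=> q).
Proof. by move=> n; exact: measurable_cst. Qed.

Lemma qmeasB f g : qmeas f -> qmeas g -> qmeas (fun x => f x - g x).
Proof.
move=> mf mg n; under eq_fun do rewrite qcB; exact: measurable_funB.
Qed.

Lemma qmeasZ (a : T -> R) f : measurable_fun setT a -> qmeas f ->
  qmeas (fun x => a x *: f x).
Proof.
move=> ma mf n; under eq_fun do rewrite qcZ; exact: measurable_funM.
Qed.

Lemma measurable_qnorm f : qmeas f -> measurable_fun setT (fun x => qnorm (f x)).
Proof.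
move=> mf; apply: measurableT_comp.
  apply: continuous_measurable_fun; exact: sqrt_continuous.
have h n := measurable_funX 2 (mf n).
exact: measurable_funD (measurable_funD (measurable_funD (h 0) (h 1)) (h 2)) (h 3).
Qed.

End quat_measurability.

Lemma qmeas_comp d1 d2 (T1 : measurableType d1) (T2 : measurableType d2)
    (R : realType) (f : T2 -> quat R) (g : T1 -> T2) :
  qmeas f -> measurable_fun setT g -> qmeas (fun x => f (g x)).
Proof. by move=> mf mg n; exact: (measurableT_comp (mf n) mg). Qed.

Section qint_theory.
Context (R : realType).
Notation RR := (measurableTypeR R).
Notation mu2 := (@lebesgue2 R).
Implicit Types f g : RR * RR -> quat R.

Lemma borel_measurableP f : borel_measurable f <-> qmeas f.
Proof.
split=> [[m0 m1 m2 m3] [|[|[|n]]]//|mf].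
by split; [exact: (mf 0)|exact: (mf 1)|exact: (mf 2)|exact: (mf 3)].
Qed.

Definition qintegrable f :=
  forall n, mu2.-integrable setT (fun x => (qc n (f x))%:E).

Lemma qintegrable_qmeas f : qintegrable f -> qmeas f.
Proof. by move=> fi n; apply/measurable_EFinP; exact: measurable_int (fi n). Qed.

Lemma qintegrableP f : qintegrable f <->
  qmeas f /\ (\int[mu2]_x (qnorm (f x))%:E < +oo)%E.
Proof.
split=> [fi|[mf foo] n].
  have mf := qintegrable_qmeas fi; split => //.
  have mn n : measurable_fun setT (fun x => (`|qc n (f x)|)%:E).
    by apply/measurable_EFinP; exact: measurableT_comp.
  apply: (@le_lt_trans _ _ (\int[mu2]_x \sum_(n < 4) (`|qc n (f x)|)%:E)%E).
    apply: ge0_le_integral => //.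
    - by move=> x _; rewrite lee_fin qnorm_ge0.
    - by apply/measurable_EFinP; exact: measurable_qnorm.
    - by apply: emeasurable_sum => n _; exact: mn.
    - by move=> x _; rewrite sumEFin lee_fin qnorm_le_sum.
  rewrite ge0_integral_sum//.
  apply: lte_sum_pinfty => n _.
  by have /integrableP[_] := fi n.
apply/integrableP; split; first exact/measurable_EFinP.
apply: le_lt_trans foo; apply: ge0_le_integral => //.
- by apply/measurable_EFinP; exact: measurableT_comp.
- by apply/measurable_EFinP; exact: measurable_qnorm.
- by move=> x _ /=; rewrite lee_fin qc_le.
Qed.

Lemma qintegrable_le f (g : RR * RR -> R) : qmeas f ->
  mu2.-integrable setT (EFin \o g) -> (forall x, qnorm (f x) <= g x) ->
  qintegrable f.
Proof.
move=> mf /integrableP[mg goo] fg; apply/qintegrableP; split => //.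
apply: le_lt_trans goo; apply: ge0_le_integral => //.
- by move=> x _; rewrite lee_fin qnorm_ge0.
- by apply/measurable_EFinP; exact: measurable_qnorm.
- exact: measurableT_comp.
- by move=> x _ /=; rewrite lee_fin; apply: le_trans (fg x) (ler_norm _).
Qed.

Lemma integrable_qnorm f : qintegrable f ->
  mu2.-integrable setT (EFin \o (fun x => qnorm (f x))).
Proof.
move=> /qintegrableP[mf foo]; apply/integrableP; split.
  by apply/measurable_EFinP; exact: measurable_qnorm.
by under eq_integral do rewrite /= ger0_norm ?qnorm_ge0//.
Qed.

Lemma qc_qint n f : qc n (qint f) = \int[mu2]_x qc n (f x).
Proof. by move: n => [|[|[|n]]]. Qed.

(** The integral commutes with real-linear maps, here given by the rows of a 4 by 4 matrix. Left and
    right multiplication by a fixed quaternion are two different instances. *)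
Lemma qint_lin (phi : quat R -> quat R) f :
  (forall n, exists a : nat -> R, forall q, qc n (phi q) = \sum_(i < 4) a i * qc i q) ->
  qintegrable f -> qintegrable (phi \o f) /\ qint (phi \o f) = phi (qint f).
Proof.
move=> phil fi.
have iZ (a : R) i : mu2.-integrable setT (fun x => (a * qc i (f x))%:E).
  exact: (integrableZl measurableT a (fi i)).
split=> [n|].
  have [a ha] := phil n.
  rewrite (_ : (fun x => _) = (fun x => \sum_(i < 4) (a i * qc i (f x))%:E)%E).
    by apply: integrable_sum => // i _; exact: iZ.
  by apply/funext => x; rewrite /= ha sumEFin.
apply: quat_ext => n; have [a ha] := phil n.
rewrite qc_qint ha.
under eq_Rintegral do rewrite /= ha.
rewrite /Rintegral; under eq_integral do rewrite -sumEFin.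
rewrite integral_sum//.
  rewrite -sum_fine => [|i _]; last exact: (integrable_fin_num measurableT (iZ _ _)).
apply: eq_bigr => i _; rewrite qc_qint.
rewrite -[LHS]/(\int[mu2]_x (a i * qc i (f x))) RintegralZl//.
exact: fi.
Qed.

Let mull_lin (c : quat R) n :
  exists a : nat -> R, forall q, qc n (c * q) = \sum_(i < 4) a i * qc i q.
Proof.
(* The matrix entries are the components of [c] times the units 1, i, j, k. *)
exists (fun i => qc n (c * Quat (i == 0)%:R (i == 1)%:R (i == 2)%:R (i == 3)%:R)).
move=> q; rewrite !big_ord_recr big_ord0 /=.
by move: n => [|[|[|n]]] /=; ring.
Qed.

Let mulr_lin (c : quat R) n :
  exists a : nat -> R, forall q, qc n (q * c) = \sum_(i < 4) a i * qc i q.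
Proof.
exists (fun i => qc n (Quat (i == 0)%:R (i == 1)%:R (i == 2)%:R (i == 3)%:R * c)).
move=> q; rewrite !big_ord_recr big_ord0 /=.
by move: n => [|[|[|n]]] /=; ring.
Qed.

Lemma qintMl c f : qintegrable f -> qint (fun x => c * f x) = c * qint f.
Proof. by move=> fi; have [_] := qint_lin (mull_lin c) fi. Qed.

Lemma qintMr c f : qintegrable f -> qint (fun x => f x * c) = qint f * c.
Proof. by move=> fi; have [_] := qint_lin (mulr_lin c) fi. Qed.

Lemma qintZ c f : qintegrable f -> qint (fun x => c *: f x) = c *: qint f.
Proof.
move=> fi; rewrite -[f in LHS]/(fun x => f x).
under eq_fun do rewrite -[f _]mul1r -scaleq_mull.
by rewrite qintMl// scaleq_mull mul1r.
Qed.

Lemma qintB f g : qintegrable f -> qintegrable g ->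
  qint (fun x => f x - g x) = qint f - qint g.
Proof.
move=> fi gi; apply: quat_ext => n; rewrite qcB !qc_qint.
under eq_Rintegral do rewrite qcB.
by rewrite RintegralB; [|by []|exact: fi|exact: gi].
Qed.

Lemma qintegrableB f g : qintegrable f -> qintegrable g ->
  qintegrable (fun x => f x - g x).
Proof.
move=> fi gi n; under eq_fun do rewrite qcB.
exact: (integrableB measurableT (fi n) (gi n)).
Qed.

Lemma qc_qint_le n f : qmeas f ->
  ((`|qc n (qint f)|)%:E <= \int[mu2]_x (qnorm (f x))%:E)%E.
Proof.
move=> mf; rewrite qc_qint; apply: (le_trans (Rintegral_abs_le mu2 (mf n))).
apply: ge0_le_integral => //.
- by apply/measurable_EFinP; exact: measurableT_comp.
- by apply/measurable_EFinP; exact: measurable_qnorm.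
- by move=> x _; rewrite lee_fin qc_le.
Qed.

Lemma qmeas_qint (F : (RR * RR) * (RR * RR) -> quat R) : qmeas F ->
  qmeas (fun x => qint (fun y => F (x, y))).
Proof.
move=> mF n; under eq_fun do rewrite qc_qint.
exact: (measurable_Rintegral_param mu2 (mF n)).
Qed.

Lemma qint_fubini (F : (RR * RR) * (RR * RR) -> quat R) (a b : RR * RR -> R) :
  qmeas F -> mu2.-integrable setT (EFin \o a) ->
  mu2.-integrable setT (EFin \o b) ->
  (forall x y, qnorm (F (x, y)) <= a x * b y) ->
  qint (fun x => qint (fun y => F (x, y))) =
  qint (fun y => qint (fun x => F (x, y))).
Proof.
move=> mF ia ib Fab; apply: quat_ext => n; rewrite qc_qint [RHS]qc_qint.
under eq_Rintegral do rewrite qc_qint.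
under [RHS]eq_Rintegral do rewrite qc_qint.
apply: (Rfubini_dom (mF n) ia ib) => x y.
by apply: (le_trans (qc_le n _)); apply: (le_trans (Fab x y)); exact: ler_norm.
Qed.

Lemma qint_ae f g : {ae mu2, forall x, f x = g x} -> qint f = qint g.
Proof.
move=> fg; apply: quat_ext => n; rewrite !qc_qint /Rintegral; congr fine.
apply: ae_eq_integral_nonmeasurable.
by apply: filterS fg => x ->.
Qed.

End qint_theory.



(** * The quaternion Fourier transform *)

Section fourier_kernel.
Context (R : realType).
Notation RR := (measurableTypeR R).
Notation mu2 := (@lebesgue2 R).

(** The factor common to the QFT, where it stands to the right of [f], and to the generalized
    translation, where it stands to the left of [H]. This shared factor is what makes the
    convolution formula an exchange of integrals. *)
Definition fkernel (w y : RR * RR) : quat R :=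
  qexp (- (w.1 * y.1) *: qi) * qexp (- (w.2 * y.2) *: qj).

(** Real coefficients in the expansion of (cos a - i sin a) (cos b - j sin b), paired with the units
    1, -i, -j and ij = k of [funit]. The parity of [j] chooses between cosine and sine in the first
    variable, the test [j < 2] in the second. *)
Definition ftrig (j : nat) : RR * RR -> RR * RR -> R := trig2 (~~ odd j) (j < 2)%N.

Definition funit (j : nat) : quat R :=
  match j with O => 1 | S O => - qi | S (S O) => - qj | _ => qk end.

Lemma fkernelE w y : fkernel w y = \sum_(j < 4) ftrig j w y *: funit j.
Proof.
rewrite /fkernel qexp_qi qexp_qj !cosN !sinN !big_ord_recr big_ord0 /=.
by rewrite /ftrig /trig2 /=; congr Quat; rewrite /=; ring.
Qed.

Lemma qnorm_funit j : qnorm (funit j) = 1.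
Proof.
by move: j => [|[|[|j]]]; rewrite /qnorm /=
  ?oppr0 ?sqrrN !expr0n !expr1n /= ?addr0 ?add0r sqrtr1.
Qed.

Lemma qnorm_fkernel w y : qnorm (fkernel w y) = 1.
Proof.
rewrite qnormM qexp_qi qexp_qj /qnorm /= !expr0n /= !addr0 !cos2Dsin2.
by rewrite sqrtr1 mulr1.
Qed.

Lemma fkernel_sym w y : fkernel w y = fkernel y w.
Proof. by rewrite /fkernel ![y.1 * _]mulrC ![y.2 * _]mulrC. Qed.

Lemma measurable_ftrig j : measurable_fun setT
  (fun p : (RR * RR) * (RR * RR) => ftrig j p.1 p.2).
Proof. exact: measurable_trig2. Qed.

Lemma qmeas_fkernel :
  qmeas (fun p : (RR * RR) * (RR * RR) => fkernel p.1 p.2).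
Proof.
move=> n; under eq_fun do rewrite fkernelE qc_sum.
apply: measurable_sum => j; under eq_fun do rewrite qcZ.
apply: measurable_funM; first exact: measurable_ftrig.
exact: measurable_cst.
Qed.

Lemma qmeas_fkernel_l y : qmeas (fun w => fkernel w y).
Proof. exact: (qmeas_comp qmeas_fkernel (measurable_pair2 y)). Qed.

Let C : R := 40 / 3 * pi.

Section bound.
Variable K : nat -> RR * RR -> quat R.
Hypothesis Ki : forall j, qintegrable (K j).

(** [K j] will absorb the unit [funit j] from whichever side it stands on, so that one estimate
    serves both the left and the right kernel. *)
Let Phi (y : RR * RR) := qint (fun w => \sum_(j < 4) ftrig j w y *: K j w).

Let T n j := trig_transform2 (~~ odd j) (j < 2)%N (fun w => qc n (K j w)).

Let PhiE n y : qc n (Phi y) = \sum_(j < 4) T n j y.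
Proof.
rewrite qc_qint; under eq_Rintegral do rewrite qc_sum.
rewrite /Rintegral; under eq_integral do rewrite -sumEFin.
have iT j : mu2.-integrable setT (fun w => (qc n (ftrig j w y *: K j w))%:E).
  under eq_fun do rewrite qcZ.
  apply: integrable_le1M (Ki j n); last by move=> w; exact: trig2_le1.
  exact: (measurableT_comp (measurable_ftrig j) (measurable_pair2 y)).
rewrite integral_sum//.
rewrite -sum_fine => [|j _]; last exact: (integrable_fin_num measurableT (iT j)).
apply: eq_bigr => j _; rewrite /T /trig_transform2 /Rintegral; congr fine.
by apply: eq_integral => w _; rewrite qcZ.
Qed.

(** 64 is 4 * 4 * 4: the square of a sum of four terms is at most 4 times the sum of their squares,
    and there are four terms [j] in each of four components [n]. *)
Lemma fourier_sum_L2 (X : \bar R) :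
  (forall j, \int[mu2]_w (qnorm (K j w) ^+ 2)%:E <= X)%E ->
  (\int[mu2]_y (qnorm (Phi y) ^+ 2)%:E <= (64 * C ^+ 2)%:E * X)%E.
Proof.
move=> KX.
have X0 : (0 <= X)%E.
  by apply: le_trans (KX 0%N); apply: integral_ge0 => w _; rewrite lee_fin sqr_ge0.
have mT n j : measurable_fun setT (T n j).
  exact: measurable_trig_transform2 (Ki j n).
have mT2 n j : measurable_fun setT (fun y => (4 * T n j y ^+ 2)%:E).
  by apply/measurable_EFinP; apply: measurable_funM => //; exact: measurable_funX.
have T0 n j y : (0 <= (4 * T n j y ^+ 2)%:E)%E.
  by rewrite lee_fin mulr_ge0// sqr_ge0.
have Tle n j : (\int[mu2]_y (4 * T n j y ^+ 2)%:E <= (4 * C ^+ 2)%:E * X)%E.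
  under eq_integral do rewrite EFinM.
  rewrite ge0_integralZl//; last 2 first.
  - by apply/measurable_EFinP; exact: measurable_funX.
  - by move=> y _; rewrite lee_fin sqr_ge0.
  rewrite (EFinM 4 (C ^+ 2)) -(muleA 4%:E); apply: lee_wpmul2l; first by rewrite lee_fin.
  apply: (le_trans (trig_transform2_L2 _ _ (Ki j n))).
  apply: lee_wpmul2l; first by rewrite lee_fin sqr_ge0.
  apply: le_trans (KX j); have mK := qintegrable_qmeas (Ki j).
  apply: ge0_le_integral => //.
  - by move=> w _; rewrite lee_fin sqr_ge0.
  - by apply/measurable_EFinP; exact: measurable_funX.
  - by apply/measurable_EFinP; apply: measurable_funX; exact: measurable_qnorm.
  - by move=> w _; rewrite lee_fin qnorm2E sqr_qc_le.
apply: (@le_trans _ _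
    (\int[mu2]_y \sum_(n < 4) \sum_(j < 4) (4 * T n j y ^+ 2)%:E)%E).
  apply: ge0_le_integral => //.
  - by move=> y _; rewrite lee_fin sqr_ge0.
  - apply/measurable_EFinP; under eq_fun do rewrite qnorm2E qnorm2_sum.
    apply: measurable_sum => n; apply: measurable_funX.
    by under eq_fun do rewrite PhiE; apply: measurable_sum => j.
  - by apply: emeasurable_sum => n _; apply: emeasurable_sum.
  - move=> y _; rewrite qnorm2E qnorm2_sum.
    under [X in (_ <= X)%E]eq_bigr do rewrite sumEFin.
    rewrite sumEFin lee_fin; apply: ler_sum => n _; rewrite PhiE.
    rewrite !big_ord_recr !big_ord0 /= !add0r.
    move: (T n 0%N y) (T n 1%N y) (T n 2%N y) (T n 3%N y) => a b c d.
    have := sqr_ge0 (a - b); have := sqr_ge0 (a - c); have := sqr_ge0 (a - d).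
    have := sqr_ge0 (b - c); have := sqr_ge0 (b - d); have := sqr_ge0 (c - d).
    nra.
rewrite ge0_integral_sum//; last 2 first.
- by move=> n; exact: emeasurable_sum.
- by move=> n y _; exact: sume_ge0.
have S (Y : \bar R) : (0 <= Y -> \sum_(n < 4) Y = 4%:E * Y)%E.
  rewrite !big_ord_recr big_ord0 /= add0e; case: Y => [r| |]// _.
    by rewrite -!EFinD -EFinM; congr EFin; ring.
  by rewrite mulry gtr0_sg// mul1e.
apply: (@le_trans _ _ (\sum_(n < 4) \sum_(j < 4) ((4 * C ^+ 2)%:E * X))%E).
  apply: lee_sum => n _; rewrite ge0_integral_sum//.
  by apply: lee_sum => j _; exact: Tle.
have Y0 : (0 <= (4 * C ^+ 2)%:E * X)%E by rewrite mule_ge0// lee_fin mulr_ge0// sqr_ge0.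
rewrite (S _ Y0) S; last exact: mule_ge0.
rewrite !muleA -!EFinM.
by rewrite (_ : 4 * 4 * (4 * C ^+ 2) = 64 * C ^+ 2)//; ring.
Qed.

End bound.

(** Units have norm 1, so every [K j] has the L^2 norm of [K]. This version is for [gtranslate], the
    next one for [qft_int]. *)
Lemma fourier_l_L2 (K : RR * RR -> quat R) : qintegrable K ->
  (\int[mu2]_y (qnorm (qint (fun w => fkernel w y * K w)) ^+ 2)%:E <=
   (64 * C ^+ 2)%:E * \int[mu2]_w (qnorm (K w) ^+ 2)%:E)%E.
Proof.
move=> Ki; pose Kj (j : nat) w := funit j * K w.
have Kji j : qintegrable (Kj j).
  apply: (qintegrable_le _ (integrable_qnorm Ki)).
    by apply: qmeasM; [exact: qmeas_cst|exact: qintegrable_qmeas].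
  by move=> w; rewrite qnormM qnorm_funit mul1r.
apply: le_trans (fourier_sum_L2 Kji _); last first.
  by move=> j; under eq_integral do rewrite qnormM qnorm_funit mul1r.
under eq_integral do under eq_fun do rewrite fkernelE mulr_suml.
by under eq_integral do under eq_fun do under eq_bigr do rewrite scaleq_mull.
Qed.

Lemma fourier_r_L2 (K : RR * RR -> quat R) : qintegrable K ->
  (\int[mu2]_y (qnorm (qint (fun w => K w * fkernel w y)) ^+ 2)%:E <=
   (64 * C ^+ 2)%:E * \int[mu2]_w (qnorm (K w) ^+ 2)%:E)%E.
Proof.
move=> Ki; pose Kj (j : nat) w := K w * funit j.
have Kji j : qintegrable (Kj j).
  apply: (qintegrable_le _ (integrable_qnorm Ki)).
    by apply: qmeasM; [exact: qintegrable_qmeas|exact: qmeas_cst].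
  by move=> w; rewrite qnormM qnorm_funit mulr1.
apply: le_trans (fourier_sum_L2 Kji _); last first.
  by move=> j; under eq_integral do rewrite qnormM qnorm_funit mulr1.
under eq_integral do under eq_fun do rewrite fkernelE mulr_sumr.
by under eq_integral do under eq_fun do under eq_bigr do rewrite scaleq_mulr.
Qed.

End fourier_kernel.



(** * Pairings and convergence in L^2 *)

Section L2_pairing.
Context (R : realType).
Notation RR := (measurableTypeR R).
Notation mu2 := (@lebesgue2 R).
Implicit Types a b : RR * RR -> quat R.

(** Cauchy-Schwarz in the form of Young's inequality, from (t u - v)^2 >= 0. The free parameter [t]
    avoids square roots of possibly infinite integrals. *)
Lemma L2_pairing_le a b (t : R) : qmeas a -> qmeas b -> 0 < t ->
  (\int[mu2]_x (qnorm (a x) * qnorm (b x))%:E <=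
   (t / 2)%:E * \int[mu2]_x (qnorm (a x) ^+ 2)%:E +
   (t^-1 / 2)%:E * \int[mu2]_x (qnorm (b x) ^+ 2)%:E)%E.
Proof.
move=> ma mb t0.
have mn2 (f : RR * RR -> quat R) : qmeas f ->
    measurable_fun setT (fun x => (qnorm (f x) ^+ 2)%:E).
  move=> mf; apply/measurable_EFinP; apply: measurable_funX.
  exact: measurable_qnorm.
have n20 (f : RR * RR -> quat R) x : (0 <= (qnorm (f x) ^+ 2)%:E)%E.
  by rewrite lee_fin sqr_ge0.
have t2 : 0 <= t / 2 by rewrite divr_ge0// ltW.
have tV2 : 0 <= t^-1 / 2 by rewrite divr_ge0// invr_ge0 ltW.
rewrite -!ge0_integralZl ?lee_fin//; [|exact: mn2|exact: mn2].
rewrite -ge0_integralD//; first last.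
- by apply: emeasurable_funM => //; exact: mn2.
- by move=> x _; rewrite -EFinM lee_fin mulr_ge0// sqr_ge0.
- by apply: emeasurable_funM => //; exact: mn2.
- by move=> x _; rewrite -EFinM lee_fin mulr_ge0// sqr_ge0.
apply: ge0_le_integral => //.
- by move=> x _; rewrite lee_fin mulr_ge0// qnorm_ge0.
- by apply/measurable_EFinP; apply: measurable_funM; exact: measurable_qnorm.
- by apply: emeasurable_funD; apply: emeasurable_funM => //; exact: mn2.
- move=> x _; rewrite -!EFinM -EFinD lee_fin.
  move: (qnorm (a x)) (qnorm (b x)) => u v.
  have := mulr_ge0 tV2 (sqr_ge0 (t * u - v)).
  suff -> : t^-1 / 2 * (t * u - v) ^+ 2 = t / 2 * u ^+ 2 + t^-1 / 2 * v ^+ 2 - u * v.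
    lra.
  by field; rewrite gt_eqF.
Qed.

Lemma L2_pairing_fin a b : qmeas a -> qmeas b ->
  (\int[mu2]_x (qnorm (a x) ^+ 2)%:E < +oo)%E ->
  (\int[mu2]_x (qnorm (b x) ^+ 2)%:E < +oo)%E ->
  qintegrable (fun x => a x * b x).
Proof.
move=> ma mb aoo boo; apply/qintegrableP; split; first exact: qmeasM.
under eq_integral do rewrite qnormM.
apply: (le_lt_trans (L2_pairing_le ma mb ltr01)).
have ge0 (f : RR * RR -> quat R) : (0 <= \int[mu2]_x (qnorm (f x) ^+ 2)%:E)%E.
  by apply: integral_ge0 => x _; rewrite lee_fin sqr_ge0.
by apply: lte_add_pinfty; apply: lte_mul_pinfty; rewrite ?lee_fin// divr_ge0// invr_ge0.
Qed.

Lemma L2_pairing_small b (e : R) : qmeas b ->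
  (\int[mu2]_x (qnorm (b x) ^+ 2)%:E < +oo)%E -> 0 < e ->
  exists2 d : R, 0 < d & forall a, qmeas a ->
    (\int[mu2]_x (qnorm (a x) ^+ 2)%:E <= d%:E)%E ->
    (\int[mu2]_x (qnorm (a x) * qnorm (b x))%:E <= e%:E)%E.
Proof.
move=> mb boo e0.
have B0 : (0 <= \int[mu2]_x (qnorm (b x) ^+ 2)%:E)%E.
  by apply: integral_ge0 => x _; rewrite lee_fin sqr_ge0.
have Bfin : (\int[mu2]_x (qnorm (b x) ^+ 2)%:E)%E \is a fin_num by rewrite ge0_fin_numE.
pose B := fine (\int[mu2]_x (qnorm (b x) ^+ 2)%:E)%E.
have B0' : 0 <= B by exact: fine_ge0.
(* [B + 1] rather than [B] keeps [t] positive when [b] vanishes almost everywhere. With [d = e / t]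
   each of the two terms is at most [e / 2]. *)
pose t := (B + 1) / e.
have B1 : 0 < B + 1 by lra.
have t0 : 0 < t by rewrite divr_gt0.
exists (e / t) => [|a ma aled]; first by rewrite divr_gt0.
apply: (le_trans (L2_pairing_le ma mb t0)).
rewrite -(fineK Bfin) -/B.
apply: (@le_trans _ _ ((t / 2)%:E * (e / t)%:E + (t^-1 / 2)%:E * B%:E)%E).
  rewrite leeD2r//; apply: lee_wpmul2l => //.
  by rewrite lee_fin divr_ge0// ltW.
rewrite -!EFinM -EFinD lee_fin.
have -> : t / 2 * (e / t) = e / 2 by field; rewrite gt_eqF.
have -> : t^-1 / 2 * B = e / 2 * (B / (B + 1)).
  by rewrite /t; field; rewrite !gt_eqF.
have : B / (B + 1) <= 1 by rewrite ler_pdivrMr// mul1r; lra.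
have : 0 < e / 2 by rewrite divr_gt0.
nra.
Qed.

Lemma L2_distance_le a b c : qmeas a -> qmeas b -> qmeas c ->
  (\int[mu2]_x (qnorm (a x - c x) ^+ 2)%:E <=
   2%:E * \int[mu2]_x (qnorm (a x - b x) ^+ 2)%:E +
   2%:E * \int[mu2]_x (qnorm (b x - c x) ^+ 2)%:E)%E.
Proof.
move=> ma mb mc.
have mn2 (f : RR * RR -> quat R) : qmeas f ->
    measurable_fun setT (fun x => (qnorm (f x) ^+ 2)%:E).
  move=> mf; apply/measurable_EFinP; apply: measurable_funX.
  exact: measurable_qnorm.
have mab := mn2 _ (qmeasB ma mb); have mbc := mn2 _ (qmeasB mb mc).
have mac := mn2 _ (qmeasB ma mc).
have n20 (f : RR * RR -> quat R) x : (0 <= (qnorm (f x) ^+ 2)%:E)%E.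
  by rewrite lee_fin sqr_ge0.
rewrite -!ge0_integralZl ?lee_fin//; [|by move=> x _; rewrite lee_fin sqr_ge0..].
rewrite -ge0_integralD//; first last.
- exact: emeasurable_funM.
- by move=> x _; rewrite -EFinM lee_fin mulr_ge0// sqr_ge0.
- exact: emeasurable_funM.
- by move=> x _; rewrite -EFinM lee_fin mulr_ge0// sqr_ge0.
apply: ge0_le_integral => //.
- by move=> x _; rewrite lee_fin sqr_ge0.
- by apply: emeasurable_funD; exact: emeasurable_funM.
- move=> x _; rewrite -!EFinM -EFinD lee_fin !qnorm2E.
  by rewrite (_ : a x - c x = (a x - b x) + (b x - c x)) ?qnorm2D_le// addrA subrK.
Qed.

Lemma cvg_L2_near (u : nat -> RR * RR -> quat R) a (d : R) : cvg_L2 u a -> 0 < d ->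
  \forall n \near \oo, (\int[mu2]_x (qnorm (u n x - a x) ^+ 2)%:E <= d%:E)%E.
Proof.
move=> /fine_cvgP[fin cv] d0; near=> n.
rewrite -[X in (X <= _)%E]fineK; last by near: n.
rewrite lee_fin ltW//; near: n; exact: (cvgr_lt _ cv).
Unshelve. all: by end_near. Qed.

End L2_pairing.

(** * The convolution formula for integrable functions *)

Section fourier_transforms.
Context (R : realType).
Notation RR := (measurableTypeR R).
Notation mu2 := (@lebesgue2 R).
Implicit Types f F H K : RR * RR -> quat R.

Let c : R := (2 * pi)^-1.

(** The multiplicative inverse of [fkernel w x], hence the reversed order of the exponentials. *)
Definition ikernel (w x : RR * RR) : quat R :=
  qexp ((w.2 * x.2) *: qj) * qexp ((w.1 * x.1) *: qi).

Lemma qnorm_ikernel w x : qnorm (ikernel w x) = 1.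
Proof.
rewrite qnormM qexp_qi qexp_qj /qnorm /= !expr0n /= !addr0 !cos2Dsin2.
by rewrite sqrtr1 mulr1.
Qed.

Lemma qmeas_ikernel x : qmeas (fun w => ikernel w x).
Proof.
have mt b (g : RR * RR -> R) (y : R) : measurable_fun setT g ->
    measurable_fun setT (fun w => trig b (g w * y)).
  move=> mg; apply: measurableT_comp; first exact: measurable_trig.
  exact: measurable_funM.
have m0 : measurable_fun setT (fun _ : RR * RR => 0 : R) by exact: measurable_cst.
apply: qmeasM => n.
- under eq_fun do rewrite qexp_qj.
  by move: n => [|[|[|n]]] //=; [exact: (mt true snd)|exact: (mt false snd)].
- under eq_fun do rewrite qexp_qi.
  by move: n => [|[|[|n]]] //=; [exact: (mt true fst)|exact: (mt false fst)].
Qed.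

Lemma qft_intE f w : qft_int f w = c *: qint (fun x => f x * fkernel x w).
Proof.
by rewrite /qft_int; under eq_fun do rewrite -mulrA -/(fkernel w _) fkernel_sym.
Qed.

Lemma iqft_intE F x : iqft_int F x = c *: qint (fun w => F w * ikernel w x).
Proof. by rewrite /iqft_int; under eq_fun do rewrite -mulrA. Qed.

(** With [H w * ikernel w x] grouped as one function of [w], of the same norm as [H], the
    translation becomes a left-sided transform in [y]. *)
Lemma gtranslateE H x y :
  gtranslate H x y = c *: qint (fun w => fkernel w y * (H w * ikernel w x)).
Proof. by rewrite /gtranslate; under eq_fun do rewrite -!mulrA mulrA. Qed.

Lemma qmeas_qft_int f : qmeas f -> qmeas (qft_int f).
Proof.
move=> mf; rewrite (_ : qft_int f = fun w => c *: qint (fun x => f x * fkernel x w)).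
  apply: qmeasZ; first exact: measurable_cst.
  apply: (@qmeas_qint _ (fun p => f p.2 * fkernel p.2 p.1)); apply: qmeasM.
    exact: (qmeas_comp mf measurable_snd).
  under eq_fun do rewrite fkernel_sym; exact: qmeas_fkernel.
by apply/funext => w; rewrite qft_intE.
Qed.

Lemma qmeas_gtranslate H x : qmeas H -> qmeas (gtranslate H x).
Proof.
move=> mH; rewrite (_ : gtranslate H x =
    fun y => c *: qint (fun w => fkernel w y * (H w * ikernel w x))).
  apply: qmeasZ; first exact: measurable_cst.
  apply: (@qmeas_qint _ (fun p => fkernel p.2 p.1 * (H p.2 * ikernel p.2 x))).
  apply: qmeasM.
    by under eq_fun do rewrite fkernel_sym; exact: qmeas_fkernel.
  apply: (@qmeas_comp _ _ _ _ _ (fun w => H w * ikernel w x) snd) => //.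
  by apply: qmeasM => //; exact: qmeas_ikernel.
by apply/funext => y; rewrite gtranslateE.
Qed.

Lemma qint_bounded (F : RR * RR -> RR * RR -> quat R) f :
  qintegrable f -> (forall y, qmeas (F y)) ->
  (forall y x, qnorm (F y x) <= qnorm (f x)) ->
  exists2 M, 0 <= M & forall y, qnorm (qint (F y)) <= M.
Proof.
(* One copy of the L^1 norm of [f] for each of the four components. *)
move=> fi mF Ff; exists (4 * fine (\int[mu2]_x (qnorm (f x))%:E)%E).
  rewrite mulr_ge0//; apply: fine_ge0; apply: integral_ge0 => x _.
  by rewrite lee_fin qnorm_ge0.
move=> y; apply: (le_trans (qnorm_le_sum _)).
have -> : 4 * fine (\int[mu2]_x (qnorm (f x))%:E)%E =
    \sum_(n < 4) fine (\int[mu2]_x (qnorm (f x))%:E)%E.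
  by rewrite sumr_const card_ord mulr_natl.
have /qintegrableP[mf foo] := fi.
apply: ler_sum => n _; rewrite -lee_fin fineK; last first.
  by rewrite ge0_fin_numE//; apply: integral_ge0 => x _; rewrite lee_fin qnorm_ge0.
apply: (le_trans (qc_qint_le n (mF y))).
apply: ge0_le_integral => //.
- by move=> x _; rewrite lee_fin qnorm_ge0.
- by apply/measurable_EFinP; exact: measurable_qnorm.
- by apply/measurable_EFinP; exact: measurable_qnorm.
- by move=> x _; rewrite lee_fin.
Qed.

Lemma qnorm_modulated H x w : qnorm (H w * ikernel w x) = qnorm (H w).
Proof. by rewrite qnormM qnorm_ikernel mulr1. Qed.

Lemma qintegrable_modulated H x : qintegrable H ->
  qintegrable (fun w => H w * ikernel w x).
Proof.
move=> Hi; apply: (qintegrable_le _ (integrable_qnorm Hi)).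
  by apply: qmeasM; [exact: qintegrable_qmeas|exact: qmeas_ikernel].
by move=> w; rewrite qnorm_modulated.
Qed.

Lemma qintegrable_boundedM (a b : RR * RR -> quat R) M : qmeas a -> qmeas b ->
  (forall w, qnorm (a w) <= M) -> qintegrable b ->
  qintegrable (fun w => a w * b w) /\ qintegrable (fun w => b w * a w).
Proof.
move=> ma mb aM bi.
have iM := integrableZl measurableT M (integrable_qnorm bi).
split; apply: (qintegrable_le (g := fun w => M * qnorm (b w))) => //.
- exact: qmeasM.
- by move=> w; rewrite qnormM ler_wpM2r// qnorm_ge0.
- exact: qmeasM.
- by move=> w; rewrite qnormM mulrC ler_wpM2r// qnorm_ge0.
Qed.

Lemma qft_int_bounded f : qintegrable f ->
  exists M, forall w, qnorm (qft_int f w) <= M.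
Proof.
move=> fi.
have [|y x|M M0 hM] := @qint_bounded (fun w x => f x * fkernel x w) f fi.
- move=> y; apply: qmeasM; first exact: qintegrable_qmeas.
  exact: qmeas_fkernel_l.
- by rewrite qnormM qnorm_fkernel mulr1.
exists (`|c| * M) => w; rewrite qft_intE qnormZ ler_wpM2l//; exact: hM.
Qed.

Lemma gtranslate_bounded H x : qintegrable H ->
  exists M, forall y, qnorm (gtranslate H x y) <= M.
Proof.
move=> Hi.
have [|y w|M M0 hM] :=
  @qint_bounded (fun y w => fkernel w y * (H w * ikernel w x)) H Hi.
- move=> y; apply: qmeasM; first exact: qmeas_fkernel_l.
  by apply: qmeasM; [exact: qintegrable_qmeas|exact: qmeas_ikernel].
- by rewrite qnormM qnorm_fkernel mul1r qnorm_modulated.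
exists (`|c| * M) => y; rewrite gtranslateE qnormZ ler_wpM2l//; exact: hM.
Qed.

(** Both sides are iterated integrals of the one function [G] below. The factor [H w * ikernel w x]
    enters the y-integral from the right and [f y] enters the w-integral from the left, so the order
    of the factors is never changed. *)
Lemma convolution_L1 f H x : qintegrable f -> qintegrable H ->
  [/\ qintegrable (fun w => qft_int f w * H w),
      qintegrable (fun y => f y * gtranslate H x y) &
      qint (fun w => qft_int f w * (H w * ikernel w x)) =
      qint (fun y => f y * gtranslate H x y)].
Proof.
move=> fi Hi; have mf := qintegrable_qmeas fi; have mH := qintegrable_qmeas Hi.
have Ki := qintegrable_modulated x Hi.
split.
- have [M hM] := qft_int_bounded fi.
  by have [] := qintegrable_boundedM (qmeas_qft_int mf) mH hM Hi.
- have [M hM] := gtranslate_bounded x Hi.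
  by have [] := qintegrable_boundedM (qmeas_gtranslate x mH) mf hM fi.
pose G (p : (RR * RR) * (RR * RR)) :=
  c *: (f p.1 * fkernel p.1 p.2 * (H p.2 * ikernel p.2 x)).
have mG : qmeas G.
  apply: qmeasZ; first exact: measurable_cst.
  apply: qmeasM.
    apply: qmeasM; last exact: qmeas_fkernel.
    exact: (qmeas_comp mf measurable_fst).
  exact: (qmeas_comp (qintegrable_qmeas Ki) measurable_snd).
have fki w : qintegrable (fun y => f y * fkernel y w).
  apply: (qintegrable_le _ (integrable_qnorm fi)).
    by apply: qmeasM => //; exact: qmeas_fkernel_l.
  by move=> y; rewrite qnormM qnorm_fkernel mulr1.
have kKi y : qintegrable (fun w => fkernel w y * (H w * ikernel w x)).
  apply: (qintegrable_le _ (integrable_qnorm Ki)).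
    by apply: qmeasM; [exact: qmeas_fkernel_l|exact: qintegrable_qmeas].
  by move=> w; rewrite qnormM qnorm_fkernel mul1r.
have := integrableZl measurableT `|c| (integrable_qnorm fi).
move=> /(qint_fubini mG) /(_ (integrable_qnorm Hi)) fub.
have Gi1 w : qintegrable (fun y => f y * fkernel y w * (H w * ikernel w x)).
  apply: (qintegrable_le (g := fun y => qnorm (H w) * qnorm (f y))).
  - apply: qmeasM; last exact: qmeas_cst.
    exact: (qintegrable_qmeas (fki w)).
  - exact: (integrableZl measurableT (qnorm (H w)) (integrable_qnorm fi)).
  - move=> y; rewrite qnormM [X in _ * X <= _]qnorm_modulated.
    by rewrite qnormM qnorm_fkernel mulr1 mulrC.
have Gi2 y : qintegrable (fun w => f y * (fkernel w y * (H w * ikernel w x))).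
  apply: (qintegrable_le (g := fun w => qnorm (f y) * qnorm (H w))).
  - by apply: qmeasM; [exact: qmeas_cst|exact: (qintegrable_qmeas (kKi y))].
  - exact: (integrableZl measurableT (qnorm (f y)) (integrable_qnorm Hi)).
  - move=> w; rewrite qnormM (qnormM (fkernel w y)).
    by rewrite [X in _ * (_ * X) <= _]qnorm_modulated qnorm_fkernel mul1r.
have e1 w : qft_int f w * (H w * ikernel w x) = qint (fun y => G (y, w)).
  rewrite qft_intE scaleq_mull.
  have h := qintMr (H w * ikernel w x) (fki w).
  rewrite -h.
  exact: (esym (qintZ c (Gi1 w))).
have e2 y : f y * gtranslate H x y = qint (fun w => G (y, w)).
  rewrite gtranslateE scaleq_mulr.
  have h := qintMl (f y) (kKi y).
  rewrite -h.
  apply: (etrans (esym (qintZ c (Gi2 y)))).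
  by congr qint; apply/funext => w; rewrite /G /= fkernel_sym mulrA.
rewrite (funext e1) (funext e2); symmetry; apply: fub => y w.
rewrite qnormZ qnormM [X in _ * (_ * X) <= _]qnorm_modulated.
by rewrite (qnormM (f y)) qnorm_fkernel mulr1 mulrA.
Qed.

End fourier_transforms.



(** * L^2 boundedness of the transforms and passage to the limit *)

Section L2_theory.
Context (R : realType).
Notation RR := (measurableTypeR R).
Notation mu2 := (@lebesgue2 R).
Implicit Types f F H K : RR * RR -> quat R.

Let c : R := (2 * pi)^-1.

(** [c ^+ 2] comes from the prefactor of the transforms, the rest is the constant of
    [fourier_sum_L2]. *)
Let D : R := c ^+ 2 * (64 * (40 / 3 * pi) ^+ 2).

Let D_ge0 : 0 <= D.
Proof. by apply: mulr_ge0; [exact: sqr_ge0|apply: mulr_ge0 => //; exact: sqr_ge0]. Qed.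

Let L2_scale (F K : RR * RR -> quat R) (X : \bar R) (E : R) : qmeas F ->
  (forall y, K y = c *: F y) ->
  (\int[mu2]_y (qnorm (F y) ^+ 2)%:E <= E%:E * X)%E ->
  (\int[mu2]_y (qnorm (K y) ^+ 2)%:E <= (c ^+ 2 * E)%:E * X)%E.
Proof.
move=> mF KE FX; under eq_integral do
  rewrite KE qnormZ exprMn real_normK ?num_real// EFinM.
rewrite ge0_integralZl//; last 3 first.
- apply/measurable_EFinP; apply: measurable_funX; exact: measurable_qnorm.
- by move=> y _; rewrite lee_fin sqr_ge0.
- by rewrite lee_fin sqr_ge0.
by rewrite (EFinM (c ^+ 2) E) -(muleA (c ^+ 2)%:E); apply: lee_wpmul2l => //;
  rewrite lee_fin sqr_ge0.
Qed.

Lemma qft_int_L2 f : qintegrable f ->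
  (\int[mu2]_w (qnorm (qft_int f w) ^+ 2)%:E <=
   D%:E * \int[mu2]_x (qnorm (f x) ^+ 2)%:E)%E.
Proof.
move=> fi; apply: (L2_scale _ (qft_intE f) (fourier_r_L2 fi)).
apply: (@qmeas_qint _ (fun p => f p.2 * fkernel p.2 p.1)); apply: qmeasM.
  exact: (qmeas_comp (qintegrable_qmeas fi) measurable_snd).
under eq_fun do rewrite fkernel_sym; exact: qmeas_fkernel.
Qed.

Lemma gtranslate_L2 H x : qintegrable H ->
  (\int[mu2]_w (qnorm (H w) ^+ 2)%:E < +oo)%E ->
  (\int[mu2]_y (qnorm (gtranslate H x y) ^+ 2)%:E < +oo)%E.
Proof.
move=> Hi H2; have Ki := qintegrable_modulated x Hi.
apply: (@le_lt_trans _ _ (D%:E * \int[mu2]_w (qnorm (H w) ^+ 2)%:E)%E).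
  rewrite [X in (_ <= _ * X)%E](_ : _ =
      \int[mu2]_w (qnorm (H w * ikernel w x) ^+ 2)%:E)%E; last first.
    by apply: eq_integral => w _; rewrite qnorm_modulated.
  apply: (L2_scale _ (gtranslateE H x) (fourier_l_L2 Ki)).
  apply: (@qmeas_qint _ (fun p => fkernel p.2 p.1 * (H p.2 * ikernel p.2 x))).
  apply: qmeasM.
    by under eq_fun do rewrite fkernel_sym; exact: qmeas_fkernel.
  exact: (qmeas_comp (qintegrable_qmeas Ki) measurable_snd).
by apply: lte_mul_pinfty.
Qed.

Lemma qft_intB f K w : qintegrable f -> qintegrable K ->
  qft_int (fun x => f x - K x) w = qft_int f w - qft_int K w.
Proof.
move=> fi Ki; rewrite !qft_intE -scalerBr -qintB.
- by congr (_ *: qint _); apply/funext => x; rewrite mulrBl.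
- apply: (qintegrable_le _ (integrable_qnorm fi)) => [|x].
    by apply: qmeasM; [exact: (qintegrable_qmeas fi)|exact: qmeas_fkernel_l].
  by rewrite (qnormM (f x)) qnorm_fkernel mulr1.
- apply: (qintegrable_le _ (integrable_qnorm Ki)) => [|x].
    by apply: qmeasM; [exact: (qintegrable_qmeas Ki)|exact: qmeas_fkernel_l].
  by rewrite (qnormM (K x)) qnorm_fkernel mulr1.
Qed.

(** The transform of [u N] lies between [F] and [qft_int f]: its distance to [F] tends to 0 by
    assumption, and its distance to [qft_int f] is that of the transform of [u N - f], controlled by
    [qft_int_L2]. *)
Lemma qft_L2_L1 f F (u : nat -> RR * RR -> quat R) :
  qintegrable f -> qmeas F -> (forall n, qintegrable (u n)) ->
  cvg_L2 u f -> cvg_L2 (fun n => qft_int (u n)) F ->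
  {ae mu2, forall w, F w = qft_int f w}.
Proof.
move=> fi mF ui uf uF.
have mQ := qmeas_qft_int (qintegrable_qmeas fi).
have mQu n := qmeas_qft_int (qintegrable_qmeas (ui n)).
have I0 : (\int[mu2]_w (qnorm (F w - qft_int f w) ^+ 2)%:E = 0)%E.
  apply/eqP; rewrite eq_le; apply/andP; split; last first.
    by apply: integral_ge0 => w _; rewrite lee_fin sqr_ge0.
  apply/lee_addgt0Pr => e e0; rewrite add0e.
  have D1 : 0 < 2 * (1 + D) by rewrite mulr_gt0// ltr_pwDl.
  (* Chosen so that the two errors 2 e' and 2 D e' add up to [e]. *)
  pose e' := e / (2 * (1 + D)).
  have d0 : 0 < e' by rewrite divr_gt0.
  have [N _ hN] := filterI (cvg_L2_near uf d0) (cvg_L2_near uF d0).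
  have [hf hF] := hN N (leqnn N).
  apply: (le_trans (L2_distance_le mF (mQu N) mQ)).
  have -> : e = 2 * e' + 2 * (D * e').
    by rewrite /e'; field; rewrite gt_eqF// ltr_pwDl.
  rewrite (EFinD (2 * e')) (EFinM 2 e') (EFinM 2 (D * e')) (EFinM D e').
  apply: leeD; apply: lee_wpmul2l => //.
    apply: le_trans hF; under eq_integral do rewrite -qnormN opprB.
    exact: lexx.
  apply: (@le_trans _ _ (D%:E * \int[mu2]_x (qnorm (u N x - f x) ^+ 2)%:E)%E).
    have := qft_int_L2 (qintegrableB (ui N) fi).
    by under [X in (X <= _)%E -> _]eq_integral do rewrite qft_intB//.
  by apply: lee_wpmul2l => //; exact: hf.
have mn : measurable_fun setT (fun w => (qnorm (F w - qft_int f w) ^+ 2)%:E).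
  apply/measurable_EFinP; apply: measurable_funX; apply: measurable_qnorm.
  exact: qmeasB.
have /(ae_eq_integral_abs mu2 measurableT mn) : (\int[mu2]_w
    `|(qnorm (F w - qft_int f w) ^+ 2)%:E| = 0)%E.
  rewrite -[RHS]I0; apply: eq_integral => w _.
  by rewrite gee0_abs// lee_fin sqr_ge0.
apply: filterS => w /(_ I) /= [] /eqP.
by rewrite sqrf_eq0 qnorm_eq0 subr_eq0 => /eqP.
Qed.

Lemma convolution_L2 f F H x (u : nat -> RR * RR -> quat R) :
  qmeas f -> (\int[mu2]_y (qnorm (f y) ^+ 2)%:E < +oo)%E ->
  qmeas F -> (\int[mu2]_w (qnorm (F w) ^+ 2)%:E < +oo)%E ->
  qintegrable H -> (\int[mu2]_w (qnorm (H w) ^+ 2)%:E < +oo)%E ->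
  (forall n, qintegrable (u n)) ->
  cvg_L2 u f -> cvg_L2 (fun n => qft_int (u n)) F ->
  [/\ qintegrable (fun w => F w * H w),
      qintegrable (fun y => f y * gtranslate H x y) &
      qint (fun w => F w * (H w * ikernel w x)) =
      qint (fun y => f y * gtranslate H x y)].
Proof.
move=> mf f2 mF F2 Hi H2 ui uf uF.
have mH := qintegrable_qmeas Hi.
pose K w := H w * ikernel w x; pose g := gtranslate H x.
have mK : qmeas K by apply: qmeasM => //; exact: qmeas_ikernel.
have K2 : (\int[mu2]_w (qnorm (K w) ^+ 2)%:E < +oo)%E.
  by under eq_integral do rewrite qnorm_modulated.
have mg : qmeas g := qmeas_gtranslate x mH.
have g2 : (\int[mu2]_y (qnorm (g y) ^+ 2)%:E < +oo)%E := gtranslate_L2 x Hi H2.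
have FKi : qintegrable (fun w => F w * K w) by exact: L2_pairing_fin.
have fgi : qintegrable (fun y => f y * g y) by exact: L2_pairing_fin.
split=> //; first exact: L2_pairing_fin.
apply: quat_ext => n; apply/eqP; rewrite -subr_eq0 -qcB -normr_le0.
apply/ler_addgt0Pr => e e0; rewrite add0r.
have e2 : 0 < e / 2 by rewrite divr_gt0.
have [d1 d10 hd1] := L2_pairing_small mK K2 e2.
have [d2 d20 hd2] := L2_pairing_small mg g2 e2.
have [N _ hN] := filterI (cvg_L2_near uf d20) (cvg_L2_near uF d10).
have [hf hF] := hN N (leqnn N).
have mu := qintegrable_qmeas (ui N); have mQ := qmeas_qft_int mu.
have Ki := qintegrable_modulated x Hi.
have [_ ugi uE] := convolution_L1 x (ui N) Hi.
have uKi : qintegrable (fun w => qft_int (u N) w * K w).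
  have [M hM] := qft_int_bounded (ui N).
  by have [] := qintegrable_boundedM mQ mK hM Ki.
(* The identity already known for [u N] is inserted and cancels. What remains pairs a small L^2
   error with the fixed L^2 functions [g] and [K], and contributes at most [e / 2] each. *)
have -> : qint (fun w => F w * K w) - qint (fun y => f y * g y) =
    qint (fun y => (u N y - f y) * g y) - qint (fun w => (qft_int (u N) w - F w) * K w).
  have -> : (fun y => (u N y - f y) * g y) = (fun y => u N y * g y - f y * g y).
    by apply/funext => y; rewrite mulrBl.
  have -> : (fun w => (qft_int (u N) w - F w) * K w) =
      (fun w => qft_int (u N) w * K w - F w * K w).
    by apply/funext => w; rewrite mulrBl.
  rewrite (qintB ugi fgi) (qintB uKi FKi) uE.
  by rewrite opprB [RHS]addrC addrA subrK.
rewrite qcB; apply: (le_trans (ler_normB _ _)).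
rewrite [leRHS]splitr -lee_fin !EFinD; apply: leeD.
  apply: (le_trans (qc_qint_le n (qmeasM (qmeasB mu mf) mg))).
  under eq_integral do rewrite qnormM.
  exact: (hd2 _ (qmeasB mu mf) hf).
apply: (le_trans (qc_qint_le n (qmeasM (qmeasB mQ mF) mK))).
under eq_integral do rewrite qnormM.
exact: (hd1 _ (qmeasB mQ mF) hF).
Qed.

End L2_theory.



(** * From Borel representatives to the given functions *)

Section representatives.
Context (R : realType).
Notation RR := (measurableTypeR R).
Notation mu2 := (@lebesgue2 R).
Implicit Types f g F H : RR * RR -> quat R.

Lemma in_Lp_ae p f g : in_Lp p f -> {ae mu2, forall x, f x = g x} ->
  (\int[mu2]_x (qnorm (g x) ^+ p)%:E < +oo)%E.
Proof.
move=> [_ foo] fg; apply: le_lt_trans foo; rewrite le_eqVlt; apply/orP; left.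
apply/eqP/ae_eq_integral_nonmeasurable.
by apply: filterS fg => x ->.
Qed.

Lemma in_Lp_rep p f : in_Lp p f ->
  exists2 g, qmeas g & {ae mu2, forall x, f x = g x}.
Proof. by move=> [[g /borel_measurableP mg fg] _]; exists g. Qed.

Lemma in_L1_rep f g : in_Lp 1 f -> qmeas g ->
  {ae mu2, forall x, f x = g x} -> qintegrable g.
Proof. by move=> f1 mg fg; apply/qintegrableP; split => //; exact: (in_Lp_ae f1 fg). Qed.

Lemma in_L1_ae f g : qintegrable g -> {ae mu2, forall x, f x = g x} -> in_Lp 1 f.
Proof.
move=> /qintegrableP[mg goo] fg; split.
  by exists g => //; apply/borel_measurableP.
apply: le_lt_trans goo; rewrite le_eqVlt; apply/orP; left.
by apply/eqP/ae_eq_integral_nonmeasurable; apply: filterS fg => x ->.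
Qed.

(** Each value is an integral over the plane, so equality almost everywhere of the functions gives
    equality at every frequency. *)
Lemma qft_int_ae f g : {ae mu2, forall x, f x = g x} -> qft_int f = qft_int g.
Proof.
move=> fg; apply/funext => w; congr (_ *: _); apply: qint_ae.
by apply: filterS fg => x ->.
Qed.

Lemma gtranslate_ae F H x : {ae mu2, forall w, F w = H w} ->
  gtranslate F x = gtranslate H x.
Proof.
move=> FH; apply/funext => y; congr (_ *: _); apply: qint_ae.
by apply: filterS FH => w ->.
Qed.

Lemma cvg_L2_ae (u v : nat -> RR * RR -> quat R) f g :
  (forall n, {ae mu2, forall x, u n x = v n x}) ->
  {ae mu2, forall x, f x = g x} -> cvg_L2 u f -> cvg_L2 v g.
Proof.
move=> uv fg; rewrite /cvg_L2.
suff -> : (fun n => \int[mu2]_x (qnorm (u n x - f x) ^+ 2)%:E)%E =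
  (fun n => \int[mu2]_x (qnorm (v n x - g x) ^+ 2)%:E)%E by [].
apply/funext => n; apply: ae_eq_integral_nonmeasurable.
by apply: filterS2 (uv n) fg => x -> ->.
Qed.

(** The conclusion of the theorem, shared by both cases. The membership claims ensure that the
    integrals and [iqft] do not return default values. *)
Definition convolution_formula f F H : Prop :=
  (in_Lp 1 (fun w => F w * H w) \/ in_Lp 2 (fun w => F w * H w)) /\
  forall x : R * R,
    in_Lp 1 (fun y => f y * gtranslate H x y) /\
    gconv F H x = (2 * pi)^-1 *: qint (fun y => f y * gtranslate H x y).

Lemma convolution_formula_ae f F H f' F' H' :
  {ae mu2, forall x, f x = f' x} -> {ae mu2, forall x, F x = F' x} ->
  {ae mu2, forall x, H x = H' x} ->
  (forall x, [/\ qintegrable (fun w => F' w * H' w),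
      qintegrable (fun y => f' y * gtranslate H' x y) &
      qint (fun w => F' w * (H' w * ikernel w x)) =
      qint (fun y => f' y * gtranslate H' x y)]) ->
  convolution_formula f F H.
Proof.
move=> ff' FF' HH' fml.
have FH : {ae mu2, forall w, F w * H w = F' w * H' w}.
  by apply: filterS2 FF' HH' => w -> ->.
have FH1 : in_Lp 1 (fun w => F w * H w).
  (* Integrability of F H does not depend on x, so any point will do. *)
  by have [FHi _ _] := fml (0, 0); exact: in_L1_ae FHi FH.
split; first by left.
move=> x; have [_ fgi fE] := fml x.
have fg : {ae mu2, forall y, f y * gtranslate H x y = f' y * gtranslate H' x y}.
  by rewrite (gtranslate_ae x HH'); apply: filterS ff' => y ->.
split; first exact: in_L1_ae fgi fg.
(* F H lies in L^1, so [iqft] takes its integral branch and the value at each single x is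
   determined. *)
rewrite /gconv /iqft asboolT// iqft_intE (qint_ae fg) -fE; congr (_ *: _).
apply: qint_ae; apply: filterS FH => w ->.
by rewrite mulrA.
Qed.

Lemma is_qft_L2_rep f F : is_qft_L2 f F -> exists f' F' u,
  [/\ qmeas f', {ae mu2, forall x, f x = f' x},
      qmeas F', {ae mu2, forall x, F x = F' x} &
      [/\ forall n, qintegrable (u n), cvg_L2 u f' &
          cvg_L2 (fun n => qft_int (u n)) F']].
Proof.
move=> [f2 F2 [u [u12 uf uF]]].
have [f' mf' ff'] := in_Lp_rep f2; have [F' mF' FF'] := in_Lp_rep F2.
(* A Borel representative is chosen for every member of the approximating sequence. *)
have /choice[v hv] : forall n, exists v, qmeas v /\ {ae mu2, forall x, u n x = v x}.
  by move=> n; have [v] := in_Lp_rep (u12 n).1; exists v.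
exists f', F', v; split => //; split.
- by move=> n; have [mv uv] := hv n; exact: in_L1_rep (u12 n).1 mv uv.
- by apply: cvg_L2_ae uf => // n; have [] := hv n.
- apply: cvg_L2_ae uF => // n; have [_ uv] := hv n.
  by rewrite (qft_int_ae uv); exact: aeW.
Qed.

Lemma convolution_formula_L1 f F H : in_Lp 1 f -> in_Lp 1 H -> is_qft f F ->
  convolution_formula f F H.
Proof.
move=> f1 H1 fF.
have [f' mf' ff'] := in_Lp_rep f1; have [H' mH' HH'] := in_Lp_rep H1.
have fi' := in_L1_rep f1 mf' ff'; have Hi' := in_L1_rep H1 mH' HH'.
suff FF' : {ae mu2, forall w, F w = qft_int f' w}.
  apply: (convolution_formula_ae ff' FF' HH') => x; exact: convolution_L1.
case: fF => [[_]|]; first by rewrite (qft_int_ae ff').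
(* Here [f] is in L^1 and in L^2. The representatives [f'] and [g] of [f] may differ on a null set,
   which the integral transform does not see. *)
move=> /is_qft_L2_rep[g [G [u [mg fg mG FG [ui ug uG]]]]].
have gi := in_L1_rep f1 mg fg.
rewrite -(qft_int_ae ff') (qft_int_ae fg).
by apply: filterS2 FG (qft_L2_L1 gi mG ui ug uG) => w ->.
Qed.

Lemma convolution_formula_L2 f F H : in_Lp 1 H -> in_Lp 2 H -> is_qft_L2 f F ->
  convolution_formula f F H.
Proof.
move=> H1 H2 fF; have [f2 F2 _] := fF.
have [H' mH' HH'] := in_Lp_rep H1.
have [f' [F' [u [mf' ff' mF' FF' [ui uf uF]]]]] := is_qft_L2_rep fF.
apply: (convolution_formula_ae ff' FF' HH') => x.
apply: (convolution_L2 x mf' (in_Lp_ae f2 ff') mF' (in_Lp_ae F2 FF') _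
  (in_Lp_ae H2 HH') ui uf uF).
exact: in_L1_rep H1 mH' HH'.
Qed.

End representatives.

Theorem theorem3p4 (R : realType) (f h F H : R * R -> quat R)
    (hF : is_qft f F) (hH : is_qft h H)
    (hyp : [/\ in_Lp 1 h \/ in_Lp 2 h, in_Lp 1 H & in_Lp 1 f]
        \/ [/\ in_Lp 1 h \/ in_Lp 2 h, in_Lp 1 H /\ in_Lp 2 H & in_Lp 2 f]) :
  (in_Lp 1 (fun w => F w * H w) \/ in_Lp 2 (fun w => F w * H w)) /\
  forall x : R * R,
    in_Lp 1 (fun y => f y * gtranslate H x y) /\
    gconv F H x = (2 * pi)^-1 *: qint (fun y => f y * gtranslate H x y).
Proof.
case: hyp => [[_ H1 f1]|[_ [H1 H2] f2]]; first exact: convolution_formula_L1.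
(* In case (2) [F] may still be the transform in the L^1 sense; then [f] is also integrable and the
   integrable case applies. *)
case: (hF) => [[f1 _]|fF]; first exact: convolution_formula_L1.
exact: convolution_formula_L2.
Qed.
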